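(* Suppose the following hold. (1) The sets $\mathbb{U}$, $\mathbb{W}$, $\mathbb{Z}$, $\mathbb{X}_f$ are closed, convex, and contain the origin; $\mathbb{U}$ and $\mathbb{W}$ are bounded; and $\mathbb{W}$ contains the origin in its interior. (2) $Q,R,P\succeq 0$. (3) $Q\succ 0$, and either $\mathcal{X}$ is bounded or $\mathbb{X}_f=\mathbb{R}^n$. (4) $R,P\succ 0$ and $P=A'PA-A'PB(R+B'PB)^{-1}B'PA+Q$; with $K_f:=-(R+B'PB)^{-1}B'PA$, one has $(x,K_fx)\in\mathbb{Z}$ and $(A+BK_f)x+Gw\in\mathbb{X}_f$ for all $x\in\mathbb{X}_f$ and $w\in\mathbb{W}$; and $\mathbb{X}_f$ contains the origin in its interior. Then the long-term performance of DRMPC (parameters $(\varepsilon,\widehat\Sigma)$), SMPC (parameters $(0,\widehat\Sigma)$), and RMPC (parameters $(0,0)$) are equivalent, i.e., $$\lim_{k\to\infty}\mathcal{J}_k\big(x,(\varepsilon,\widehat\Sigma),\mathbb{P}\big)=\lim_{k\to\infty}\mathcal{J}_k\big(x,(0,\widehat\Sigma),\mathbb{P}\big)=\lim_{k\to\infty}\mathcal{J}_k\big(x,(0,0),\mathbb{P}\big)$$ for all $x\in\mathcal{X}$, $(\varepsilon,\widehat\Sigma)\in\mathcal{D}$, and $\mathbb{P}\in\mathcal{Q}$.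
   Context: System: $x^+=Ax+Bu+Gw$ with $A\in\mathbb{R}^{n\times n}$, $B\in\mathbb{R}^{n\times m}$, $G\in\mathbb{R}^{n\times q}$, input set $\mathbb{U}\subseteq\mathbb{R}^m$, disturbance set $\mathbb{W}\subseteq\mathbb{R}^q$, state-input constraint set $\mathbb{Z}\subseteq\mathbb{R}^n\times\mathbb{U}$, terminal set $\mathbb{X}_f\subseteq\mathbb{R}^n$, horizon $N\ge 1$. A prime denotes transpose; positive (semi)definite matrices are symmetric. Policies: $\Theta$ is the set of pairs $\theta=(\mathbf{M},\mathbf{v})$ with $\mathbf{v}=(v(0),\dots,v(N-1))\in\mathbb{R}^{Nm}$ and $\mathbf{M}\in\mathbb{R}^{Nm\times Nq}$ having blocks $M(i,j)\in\mathbb{R}^{m\times q}$ ($0\le i,j\le N-1$) with $M(i,j)=0$ for $j\ge i$. Given $x\in\mathbb{R}^n$, $\theta\in\Theta$, $\mathbf{w}=(w(0),\dots,w(N-1))$, put $u(i)=v(i)+\sum_{j=0}^{i-1}M(i,j)w(j)$, $x(0)=x$, $x(i+1)=Ax(i)+Bu(i)+Gw(i)$. $\Pi(x)$ is the set of $\theta\in\Theta$ such that for all $\mathbf{w}\in\mathbb{W}^N$: $(x(k),u(k))\in\mathbb{Z}$ for $k=0,\dots,N-1$ and $x(N)\in\mathbb{X}_f$. Feasible set: $\mathcal{X}=\{x\in\mathbb{R}^n:\Pi(x)\ne\emptyset\}$. Cost: $\ell(x,u)=x'Qx+u'Ru$, $V_f(x)=x'Px$, $J(x,\theta,\mathbf{w})=\sum_{k=0}^{N-1}\ell(x(k),u(k))+V_f(x(N))$.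 Ambiguity: $\mathcal{M}(S)$ is the set of probability distributions with zero mean for which the random variable lies in $S$ with probability one. For $d=(\varepsilon,\widehat\Sigma)$ with $\varepsilon\ge 0$, $\widehat\Sigma\succeq 0$ in $\mathbb{R}^{q\times q}$, let $\mathbb{B}_d=\{\Sigma\succeq 0:\mathrm{tr}(\widehat\Sigma+\Sigma-2(\widehat\Sigma^{1/2}\Sigma\widehat\Sigma^{1/2})^{1/2})\le\varepsilon^2\}$ and $\mathcal{P}_d=\{\mathbb{P}\in\mathcal{M}(\mathbb{W}):\mathbb{E}_{\mathbb{P}}[ww']\in\mathbb{B}_d\}$. $\mathcal{D}$ is the set of all such $d$ for which every $\Sigma\in\mathbb{B}_d$ equals $\mathbb{E}_{\mathbb{P}}[ww']$ for some $\mathbb{P}\in\mathcal{M}(\mathbb{W})$. $\mathcal{P}_d^N$ is the set of distributions of $(w(0),\dots,w(N-1))$ such that the $w(k)$ are independent and each $w(k)$ has distribution in $\mathcal{P}_d$. Controller: $V_d(x,\theta)=\max_{\mathbb{P}\in\mathcal{P}_d^N}\mathbb{E}_{\mathbb{P}}[J(x,\theta,\mathbf{w})]$, $V_d^0(x)=\min_{\theta\in\Pi(x)}V_d(x,\theta)$, and $\theta_d^0(x)$ is the set of minimizers. For each $d\in\mathcal{D}$, $\kappa_d:\mathcal{X}\to\mathbb{U}$ is a single-valued Borel measurable selection with $\kappa_d(x)\in\{v^0(0):(\mathbf{M}^0,\mathbf{v}^0)\in\theta_d^0(x)\}$. $\phi_d(k;x,\mathbf{w}_\infty)$ is the state at time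 $k$ of the closed-loop system $x^+=Ax+B\kappa_d(x)+Gw$ started at $x$ with disturbance sequence $\mathbf{w}_\infty=(w(0),w(1),\dots)\in\mathbb{W}^\infty$ (under the hypotheses $\mathcal{X}$ is invariant for this system, so this is well defined for $x\in\mathcal{X}$). The controllers with $d=(\varepsilon,\widehat\Sigma)$, $d=(0,\widehat\Sigma)$, $d=(0,0)$ are called DRMPC, SMPC, RMPC respectively. Average performance, $k\ge 1$: $\mathcal{J}_k(x,d,\mathbb{P})=\mathbb{E}_{\mathbb{P}}\big[\frac1k\sum_{i=0}^{k-1}\ell(\phi_d(i;x,\mathbf{w}_\infty),\kappa_d(\phi_d(i;x,\mathbf{w}_\infty)))\big]$, defined for any distribution $\mathbb{P}$ of $\mathbf{w}_\infty$ (not necessarily related to $d$). $\mathcal{Q}$ is the set of distributions of $\mathbf{w}_\infty$ for which the $w(k)$ are independent and identically distributed with a common marginal $\mathbb{P}_0\in\mathcal{M}(\mathbb{W})$ satisfying $\mathbb{P}_0(|w|\le\varepsilon)>0$ for all $\varepsilon>0$. *)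

(* Defs.v *)
From HB Require Import structures.
From mathcomp Require Import all_boot all_order all_algebra.
From mathcomp Require Import all_classical all_reals all_analysis.

Set Implicit Arguments.
Unset Strict Implicit.
Unset Printing Implicit Defensive.

Import Order.TTheory GRing.Theory Num.Theory.
Import numFieldNormedType.Exports.

Local Open Scope classical_set_scope.
Local Open Scope ring_scope.

Definition quad {R : realType} {n : nat} (M : 'M[R]_n) (x : 'cV[R]_n) : R :=
  (x^T *m M *m x) 0 0.

Definition psd {R : realType} {n : nat} (M : 'M[R]_n) : Prop :=
  M^T = M /\ forall x : 'cV[R]_n, 0 <= quad M x.

Definition pd {R : realType} {n : nat} (M : 'M[R]_n) : Prop :=
  M^T = M /\ forall x : 'cV[R]_n, x != 0 -> 0 < quad M x.

(* The positive semidefinite square root, which exists and is unique when M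
   is positive semidefinite; the default value 0 is used otherwise. *)
Definition sqrtm {R : realType} {n : nat} (M : 'M[R]_n) : 'M[R]_n :=
  xget 0 [set S | psd S /\ S *m S = M].

(* The library norm on column vectors is the max norm. *)
Definition enorm {R : realType} {n : nat} (x : 'cV[R]_n) : R :=
  Num.sqrt (\sum_i x i 0 ^+ 2).

(* Borel vectors, and I-indexed families of them with the product
   sigma-algebra. *)
Definition vecB (R : realType) (n : nat) : Type :=
  g_sigma_algebraType (@open 'cV[R]_n).
HB.instance Definition _ (R : realType) (n : nat) :=
  Measurable.on (vecB R n).
Definition cylinders (I : choiceType) (R : realType) (n : nat) :
    set (set (I -> vecB R n)) :=
  \bigcup_(i in [set: I])
    preimage_set_system setT (fun w : I -> vecB R n => w i) measurable.

Definition famB (I : choiceType) (R : realType) (n : nat) : Type :=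
  g_sigma_algebraType (@cylinders I R n).
HB.instance Definition _ (I : choiceType) (R : realType) (n : nat) :=
  Measurable.on (famB I R n).
Definition has_marginal {I : choiceType} {R : realType} {n : nat}
    (P : probability (famB I R n) R) (i : I) (mu : probability (vecB R n) R) :
    Prop :=
  forall B : set (vecB R n), measurable B -> P [set w | B (w i)] = mu B.

Definition indep_coord {I : choiceType} {R : realType} {n : nat}
    (P : probability (famB I R n) R) : Prop :=
  forall (s : seq I) (B : I -> set (vecB R n)),
    uniq s -> (forall i, measurable (B i)) ->
    P [set w | forall i, i \in s -> B i (w i)]
    = (\prod_(i <- s) P [set w | B i (w i)])%E.

(* Finiteness of the expectations entails integrability, because an integral
   whose positive or negative part is infinite is +oo or -oo. *)
Definition second_moment {R : realType} {q : nat}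
    (P : probability (vecB R q) R) (S : 'M[R]_q) : Prop :=
  forall i j,
    'E_P[(fun w : vecB R q => (w : 'cV[R]_q) i 0 * (w : 'cV[R]_q) j 0)%R]%E
    = (S i j)%:E.

Definition centered_on {R : realType} {q : nat} (W : set 'cV[R]_q)
    (P : probability (vecB R q) R) : Prop :=
  (forall i, 'E_P[(fun w : vecB R q => (w : 'cV[R]_q) i 0)%R]%E = 0%E)
  /\ P W = 1%E.

(* d is the pair (eps, Sigma-hat). *)
Definition gelbrich_ball {R : realType} {q : nat} (d : R * 'M[R]_q) :
    set 'M[R]_q :=
  [set S | psd S /\
    \tr (d.2 + S - 2%:R *: sqrtm (sqrtm d.2 *m S *m sqrtm d.2)) <= d.1 ^+ 2].

Definition ambiguity {R : realType} {q : nat} (W : set 'cV[R]_q)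
    (d : R * 'M[R]_q) : set (probability (vecB R q) R) :=
  [set P | centered_on W P /\
    exists S, gelbrich_ball d S /\ second_moment P S].

Definition admissible {R : realType} {q : nat} (W : set 'cV[R]_q) :
    set (R * 'M[R]_q) :=
  [set d | [/\ 0 <= d.1, psd d.2 &
    forall S, gelbrich_ball d S ->
      exists P : probability (vecB R q) R,
        centered_on W P /\ second_moment P S]].

Definition ambiguityN {R : realType} {q : nat} (W : set 'cV[R]_q) (N : nat)
    (d : R * 'M[R]_q) : set (probability (famB 'I_N R q) R) :=
  [set P | indep_coord P /\
    forall k, exists mu, ambiguity W d mu /\ has_marginal P k mu].

Definition iid_class {R : realType} {q : nat} (W : set 'cV[R]_q) :
    set (probability (famB nat R q) R) :=
  [set P | indep_coord P /\
    exists P0 : probability (vecB R q) R,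
      [/\ centered_on W P0,
          forall eps : R, 0 < eps ->
            (0 < P0 [set w : vecB R q | (enorm (w : 'cV[R]_q) <= eps)%R])%E &
          forall k, has_marginal P k P0]].

Record mpc (R : realType) (n m q : nat) := Mpc {
  sysA : 'M[R]_n;
  sysB : 'M[R]_(n, m);
  sysG : 'M[R]_(n, q);
  inU : set 'cV[R]_m;
  disW : set 'cV[R]_q;
  conZ : set ('cV[R]_n * 'cV[R]_m);
  terX : set 'cV[R]_n;
  wgtQ : 'M[R]_n;
  wgtR : 'M[R]_m;
  wgtP : 'M[R]_n;
  horizon : nat
}.

Section Mpc.
Context {R : realType} {n m q : nat} (S : mpc R n m q).
Local Notation N := (horizon S).
Local Notation vec k := 'cV[R]_k.

(* A pair of the blocks M(i, j) and the vectors v(i). *)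
Definition policy : Type :=
  (('I_N -> 'I_N -> 'M[R]_(m, q)) * ('I_N -> vec m))%type.

Definition causal : set policy :=
  [set th | forall i j : 'I_N, (i <= j)%N -> th.1 i j = 0].

Fixpoint traj (x : vec n) (u : nat -> vec m) (w : nat -> vec q) (k : nat) :
    vec n :=
  if k is k'.+1 then
    sysA S *m traj x u w k' + sysB S *m u k' + sysG S *m w k'
  else x.

Definition ext0 {k : nat} (f : 'I_N -> vec k) (i : nat) : vec k :=
  if insub i is Some j then f j else 0.

Definition input (th : policy) (w : 'I_N -> vec q) (i : 'I_N) : vec m :=
  th.2 i + \sum_(j < N | (j < i)%N) th.1 i j *m w j.

Definition state (x : vec n) (th : policy) (w : 'I_N -> vec q) (k : nat) :
    vec n :=
  traj x (ext0 (input th w)) (ext0 w) k.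

Definition feasible (x : vec n) : set policy :=
  [set th | causal th /\
    forall w : 'I_N -> vec q, (forall i, disW S (w i)) ->
      (forall k : 'I_N, conZ S (state x th w k, input th w k)) /\
      terX S (state x th w N)].

Definition feasible_set : set (vec n) := [set x | feasible x !=set0].

Definition stage (x : vec n) (u : vec m) : R :=
  quad (wgtQ S) x + quad (wgtR S) u.

Definition cost (x : vec n) (th : policy) (w : 'I_N -> vec q) : R :=
  \sum_(k < N) stage (state x th w k) (input th w k)
  + quad (wgtP S) (state x th w N).

Definition worst_cost (d : R * 'M[R]_q) (x : vec n) (th : policy) : \bar R :=
  ereal_sup [set 'E_P[fun w : famB 'I_N R q => cost x th w]%E
            | P in @ambiguityN R q (disW S) N d].

Definition optimal (d : R * 'M[R]_q) (x : vec n) : set policy :=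
  [set th | feasible x th /\
    forall th', feasible x th' ->
      (worst_cost d x th <= worst_cost d x th')%E].

(* The index i with value 0 is the first one; it exists when 0 < N. *)
Definition control_law (d : R * 'M[R]_q) (kappa : vec n -> vec m) : Prop :=
  [/\ measurable_fun (feasible_set : set (vecB R n))
        (kappa : vecB R n -> vecB R m),
      forall x, feasible_set x -> inU S (kappa x) &
      forall x, feasible_set x ->
        exists2 th, optimal d x th &
          forall i : 'I_N, val i = 0%N -> kappa x = th.2 i].

Fixpoint closed_loop (kappa : vec n -> vec m) (x : vec n) (w : nat -> vec q)
    (k : nat) : vec n :=
  if k is k'.+1 then
    sysA S *m closed_loop kappa x w k'
    + sysB S *m kappa (closed_loop kappa x w k') + sysG S *m w k'
  else x.

Definition avg_perf (kappa : vec n -> vec m) (k : nat) (x : vec n)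
    (P : probability (famB nat R q) R) : \bar R :=
  'E_P[(fun w : famB nat R q =>
    k%:R^-1 * \sum_(i < k)
      stage (closed_loop kappa x w i) (kappa (closed_loop kappa x w i)))%R]%E.

Definition gainK : 'M[R]_(m, n) :=
  - (invmx (wgtR S + (sysB S)^T *m wgtP S *m sysB S)
     *m (sysB S)^T *m wgtP S *m sysA S).

Definition riccati : Prop :=
  wgtP S = (sysA S)^T *m wgtP S *m sysA S
    - (sysA S)^T *m wgtP S *m sysB S
      *m invmx (wgtR S + (sysB S)^T *m wgtP S *m sysB S)
      *m (sysB S)^T *m wgtP S *m sysA S
    + wgtQ S.

End Mpc.

(* Main.v *)
Require Import Defs.
From HB Require Import structures.
From mathcomp Require Import all_boot all_order all_algebra.
From mathcomp Require Import all_classical all_reals all_analysis.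
From mathcomp Require Import measurable_realfun.
From mathcomp Require Import complex ring lra.

Set Implicit Arguments.
Unset Strict Implicit.
Unset Printing Implicit Defensive.

Import Order.TTheory GRing.Theory Num.Theory.
Import numFieldNormedType.Exports.

Local Open Scope classical_set_scope.
Local Open Scope ring_scope.

(** Why the three limits agree. Write [K] for the gain [gainK S], [Sg] for
   [R + B' P B] ([wgtS S] below) and [|x|_M] for [quad M x]. The Riccati equation
   completes the square ([stage_step]): along one step
<<
   l(x, u) = |x|_P - |A x + B u + G w|_P + |u - K x|_Sg
             + 2 (A x + B u)' P G w + |G w|_P.
>>
   Summed along the closed loop the first two terms telescope, the mixed term has
   mean zero because the state depends on the past noise only, and the last term
   has the same mean at every step, a number that the controller does not enter:
   [step_noise_cost]. The average cost therefore converges to that number, for any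
   parameters of the controller, as soon as the states stay bounded and the expected
   sum of the penalties [|u - K x|_Sg] stays bounded ([avg_perf_cvg]).

   The penalty vanishes on the terminal set. By the same identity the expected cost
   of a policy is [|x|_P], plus the expected sum of its penalties, plus the cost of
   the noise ([mean_cost]), under every distribution of the ambiguity set; on the
   terminal set the gain is feasible and has no penalty, so it is the only optimal
   move ([terminal_control]). The ambiguity set is nonempty because the centre of
   the ball belongs to it, which rests on the existence and uniqueness of
   positive semidefinite square roots ([psd_root_exists], [psd_root_unique]).

   The terminal set is invariant, and it is reached quickly. If the disturbance is
   zero, the policy shifted by one step is feasible and costs less by the stage cost
   ([shift_cost]); by convexity a small disturbance changes this little ([descent]).
   As the value is bounded on a bounded feasible set, and the stage cost is bounded
   below outside the terminal set, a run of [T] small disturbances leads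
   into the terminal set ([hitting]). Such a run has positive probability and is
   independent of the past, so the probabilities of being outside the terminal set
   are summable ([pout_sum]). If the terminal set is the whole space there
   is nothing to reach, and the states are bounded because [P] gives a Lyapunov
   function for the gain ([gain_loop_bounded]).

   Expectations along the closed loop make sense because the feasible set is closed,
   hence Borel ([feasible_set_closed]), so that the control law is measurable. *)

(** * Quadratic forms *)

Definition bil {R : realType} {n p : nat} (M : 'M[R]_(n, p))
    (x : 'cV[R]_n) (y : 'cV[R]_p) : R :=
  (x^T *m M *m y) 0 0.

Section Quad.
Context {R : realType}.

Lemma quadE n (M : 'M[R]_n) x : quad M x = bil M x x.
Proof. by []. Qed.

Lemma bilDl n p (M : 'M[R]_(n, p)) x y z : bil M (x + y) z = bil M x z + bil M y z.
Proof. by rewrite /bil linearD /= !mulmxDl mxE. Qed.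

Lemma bilDr n p (M : 'M[R]_(n, p)) x y z : bil M x (y + z) = bil M x y + bil M x z.
Proof. by rewrite /bil mulmxDr mxE. Qed.

Lemma bilZl n p (M : 'M[R]_(n, p)) a x y : bil M (a *: x) y = a * bil M x y.
Proof. by rewrite /bil linearZ /= -!scalemxAl mxE. Qed.

Lemma bilZr n p (M : 'M[R]_(n, p)) a x y : bil M x (a *: y) = a * bil M x y.
Proof. by rewrite /bil -!scalemxAr mxE. Qed.

Lemma bilNr n p (M : 'M[R]_(n, p)) x y : bil M x (- y) = - bil M x y.
Proof. by rewrite -scaleN1r bilZr mulN1r. Qed.

Lemma bil0l n p (M : 'M[R]_(n, p)) y : bil M 0 y = 0.
Proof. by rewrite -(scale0r (0 : 'cV[R]_n)) bilZl mul0r. Qed.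

Lemma bilDm n p (M M' : 'M[R]_(n, p)) x y : bil (M + M') x y = bil M x y + bil M' x y.
Proof. by rewrite /bil mulmxDr mulmxDl mxE. Qed.

Lemma bilNm n p (M : 'M[R]_(n, p)) x y : bil (- M) x y = - bil M x y.
Proof. by rewrite /bil mulmxN mulNmx mxE. Qed.

Lemma bil_mull n n' p (M : 'M[R]_(n, p)) (L : 'M[R]_(n, n')) x y :
  bil M (L *m x) y = bil (L^T *m M) x y.
Proof. by rewrite /bil trmx_mul !mulmxA. Qed.

Lemma bil_mulr n p p' (M : 'M[R]_(n, p)) (L : 'M[R]_(p, p')) x y :
  bil M x (L *m y) = bil (M *m L) x y.
Proof. by rewrite /bil !mulmxA. Qed.

Lemma bil_tr n p (M : 'M[R]_(n, p)) x y : bil M x y = bil M^T y x.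
Proof.
rewrite /bil -[LHS](_ : (x^T *m M *m y)^T 0 0 = _); last by rewrite mxE.
by rewrite !trmx_mul trmxK mulmxA.
Qed.

Lemma bilC n (M : 'M[R]_n) x y : M^T = M -> bil M x y = bil M y x.
Proof. by move=> sM; rewrite bil_tr sM. Qed.

Lemma bil_sum n p (M : 'M[R]_(n, p)) x y :
  bil M x y = \sum_i \sum_j M i j * (x i 0 * y j 0).
Proof.
rewrite /bil mxE (eq_bigr (fun j => \sum_i M i j * (x i 0 * y j 0))).
  by rewrite exchange_big.
by move=> j _; rewrite mxE big_distrl /=; apply: eq_bigr => i _; rewrite mxE; ring.
Qed.

Lemma quad_sum n (M : 'M[R]_n) x :
  quad M x = \sum_i \sum_j M i j * (x i 0 * x j 0).
Proof. exact: bil_sum. Qed.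

Lemma quad0 n (M : 'M[R]_n) : quad M 0 = 0.
Proof. by rewrite quadE bil0l. Qed.

Lemma quadD n (M : 'M[R]_n) x y : M^T = M ->
  quad M (x + y) = quad M x + 2 * bil M x y + quad M y.
Proof. by move=> sM; rewrite !quadE bilDl !bilDr (bilC y x sM); ring. Qed.

Lemma quadZ n (M : 'M[R]_n) a x : quad M (a *: x) = a ^+ 2 * quad M x.
Proof. by rewrite !quadE bilZl bilZr; ring. Qed.

Lemma quad_mul n p (M : 'M[R]_n) (L : 'M[R]_(n, p)) x :
  quad M (L *m x) = quad (L^T *m M *m L) x.
Proof. by rewrite quadE bil_mull bil_mulr. Qed.

Lemma quadDm n (M M' : 'M[R]_n) x : quad (M + M') x = quad M x + quad M' x.
Proof. exact: bilDm. Qed.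

Lemma quadNm n (M : 'M[R]_n) x : quad (- M) x = - quad M x.
Proof. exact: bilNm. Qed.

Lemma pd_psd n (M : 'M[R]_n) : pd M -> psd M.
Proof.
move=> [sM pM]; split => // x; have [->|x0] := eqVneq x 0; first by rewrite quad0.
exact/ltW/pM.
Qed.

Lemma psd_congr n p (M : 'M[R]_n) (L : 'M[R]_(n, p)) : psd M -> psd (L^T *m M *m L).
Proof.
move=> [sM pM]; split => [|x]; first by rewrite !trmx_mul trmxK sM mulmxA.
by rewrite -quad_mul.
Qed.

Lemma pd_psdD n (M M' : 'M[R]_n) : pd M -> psd M' -> pd (M + M').
Proof.
move=> [sM pM] [sM' pM']; split => [|x x0]; first by rewrite linearD /= sM sM'.
by rewrite quadDm ltr_wpDr // pM.
Qed.

Lemma pd_unit n (M : 'M[R]_n) : pd M -> M \in unitmx.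
Proof.
move=> [sM pM]; rewrite -row_free_unit -kermx_eq0; apply/negPn/negP.
move=> /rowV0Pn[v /sub_kermxP vM v0].
have := pM v^T; rewrite -(inj_eq trmx_inj) trmxK linear0 => /(_ v0).
by rewrite /quad trmxK vM mul0mx mxE ltxx.
Qed.

Lemma quad_convex n (M : 'M[R]_n) (s : R) x y : psd M -> 0 <= s <= 1 ->
  quad M ((1 - s) *: x + s *: y) <= (1 - s) * quad M x + s * quad M y.
Proof.
move=> [sM pM] /andP[s0 s1]; have := pM (x - y).
rewrite !quadD // !quadZ bilZl bilZr -scaleN1r quadZ bilZr => h.
rewrite -subr_ge0; set l := (X in 0 <= X).
have -> : l = s * (1 - s) * (quad M x + 2 * (-1 * bil M x y) + (-1) ^+ 2 * quad M y).
  by rewrite /l; ring.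
by rewrite !mulr_ge0 // subr_ge0.
Qed.

Lemma psd_CS n (M : 'M[R]_n) x y : psd M ->
  bil M x y ^+ 2 <= quad M x * quad M y.
Proof.
move=> [sM pM]; set a := quad M y; set b := bil M x y; set c := quad M x.
have h t : 0 <= c + 2 * (t * b) + t ^+ 2 * a.
  by have := pM (x + t *: y); rewrite quadD // bilZr quadZ.
have a0 : 0 <= a by exact: pM.
have [a1|a1] := eqVneq a 0.
  have [->|b1] := eqVneq b 0; first by rewrite a1; lra.
  have := h (- (c + 1) / b); rewrite a1 mulr0 addr0 divfK //.
  have : 0 <= c by exact: pM.
  lra.
have {}a0 : 0 < a by rewrite lt_neqAle eq_sym a1.
have := h (- b / a); rewrite -(pmulr_rge0 _ a0).
have -> : a * (c + 2 * (- b / a * b) + (- b / a) ^+ 2 * a) = c * a - b ^+ 2.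
  by field.
by rewrite subr_ge0.
Qed.

Lemma bil_delta n p (M : 'M[R]_(n, p)) i y : bil M (delta_mx i 0) y = (M *m y) i 0.
Proof. by rewrite /bil trmx_delta -mulmxA -rowE mxE. Qed.

Lemma psd_quad0 n (M : 'M[R]_n) x : psd M -> quad M x = 0 -> M *m x = 0.
Proof.
move=> pM q0; apply/colP => i; rewrite [RHS]mxE.
have := psd_CS (delta_mx i 0) x pM; rewrite q0 mulr0 bil_delta => h.
by apply/eqP; rewrite -sqrf_eq0 eq_le h sqr_ge0.
Qed.

(** Cauchy-Schwarz in the form of [Q], applied to [x] and [Q^-1 e_i]. *)
Lemma pd_coord_le n (Q : 'M[R]_n) : pd Q ->
  exists2 c : R, 0 <= c & forall (x : 'cV[R]_n) i, x i 0 ^+ 2 <= c * quad Q x.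
Proof.
move=> pQ; pose e i : 'cV[R]_n := invmx Q *m delta_mx i 0.
have q0 x : 0 <= quad Q x by exact: (pd_psd pQ).2.
exists (\sum_i quad Q (e i)); first exact: sumr_ge0.
move=> x i; have := psd_CS (e i) x (pd_psd pQ).
have -> : bil Q (e i) x = x i 0.
  rewrite bilC ?pQ.1 // bil_mulr mulmxV ?pd_unit // bilC ?trmx1 //.
  by rewrite bil_delta mul1mx.
move=> /le_trans; apply; apply: ler_wpM2r => //.
by rewrite (bigD1 i) //= lerDl sumr_ge0.
Qed.

Lemma quad_le n (M : 'M[R]_n) : exists2 c : R, 0 <= c &
  forall (x : 'cV[R]_n) b, (forall i, x i 0 ^+ 2 <= b) -> quad M x <= c * b.
Proof.
exists (\sum_i \sum_j `|M i j|); first by rewrite !sumr_ge0 // => i _; apply: sumr_ge0.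
move=> x b xb; rewrite quad_sum mulr_suml; apply: ler_sum => i _.
rewrite mulr_suml; apply: ler_sum => j _.
rewrite (le_trans (ler_norm _)) // normrM ler_wpM2l // normrM.
have h := sqr_ge0 (`|x i 0| - `|x j 0|).
have := xb i; have := xb j; rewrite -[x i 0 ^+ 2]real_normK ?num_real //.
rewrite -[x j 0 ^+ 2]real_normK ?num_real //; nra.
Qed.

Lemma mulmx_trl_eq0 n p (M : 'M[R]_(n, p)) : M^T *m M = 0 -> M = 0.
Proof.
move=> h; apply/matrixP => i j; have := congr1 (fun A : 'M[R]_p => A j j) h.
rewrite !mxE => /eqP; rewrite psumr_eq0 => [/allP/(_ i (mem_index_enum _))|k _].
  by rewrite mxE -expr2 sqrf_eq0 => /eqP.
by rewrite mxE -expr2 sqr_ge0.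
Qed.

Lemma tr_psd_ge0 n (M : 'M[R]_n) : psd M -> 0 <= \tr M.
Proof.
move=> pM; apply: sumr_ge0 => i _.
have := pM.2 (delta_mx i 0); rewrite quadE bil_delta.
by rewrite -colE mxE.
Qed.

Lemma psd_tr0 n (M : 'M[R]_n) : psd M -> \tr M = 0 -> M = 0.
Proof.
move=> pM t0; have d i : M i i = 0.
  have h j : 0 <= M j j.
    by have := pM.2 (delta_mx j 0); rewrite quadE bil_delta -colE mxE.
  move/eqP: t0; rewrite psumr_eq0 => [/allP/(_ i (mem_index_enum _))/eqP //|k _].
  exact: h.
apply/matrixP => i j; have := @psd_quad0 _ M (delta_mx j 0) pM.
rewrite quadE bil_delta -colE mxE d => /(_ erefl) /colP/(_ i).
by rewrite !mxE.
Qed.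

Lemma psd_sqr_eq0 n (X D : 'M[R]_n) : psd X -> D^T *m X *m D = 0 -> X *m D = 0.
Proof.
move=> pX h; apply/matrixP => i j; have := @psd_quad0 _ X (col j D) pX.
have -> : quad X (col j D) = 0.
  by rewrite colE quad_mul h quadE bil_delta mul0mx mxE.
by move=> /(_ erefl)/colP/(_ i); rewrite colE mulmxA -colE !mxE.
Qed.

(** With [D = X - Y], [X D + D Y = 0] makes the traces of the positive
   semidefinite matrices [D X D] and [D Y D] cancel, so that both vanish, and
   [D ^ 2 = X D - Y D = 0]. *)
Lemma psd_root_unique n (X Y : 'M[R]_n) :
  psd X -> psd Y -> X *m X = Y *m Y -> X = Y.
Proof.
move=> pX pY XY; pose D := X - Y.
have sD : D^T = D by rewrite /D linearB /= pX.1 pY.1.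
have h : X *m D + D *m Y = 0.
  by rewrite mulmxBr mulmxBl XY addrA subrK subrr.
have t : \tr (D^T *m X *m D) + \tr (D^T *m Y *m D) = 0.
  rewrite [X in _ + X]mxtrace_mulC sD -mulmxA -linearD /= -mulmxDr.
  by rewrite h mulmx0 linear0.
have pDX := psd_congr D pX; have pDY := psd_congr D pY.
have [tX tY] : \tr (D^T *m X *m D) = 0 /\ \tr (D^T *m Y *m D) = 0.
  have := tr_psd_ge0 pDX; have := tr_psd_ge0 pDY; split; lra.
have XD := psd_sqr_eq0 pX (psd_tr0 pDX tX).
have YD := psd_sqr_eq0 pY (psd_tr0 pDY tY).
apply/eqP; rewrite -subr_eq0 -/D; apply/eqP/mulmx_trl_eq0.
by rewrite sD {1}/D mulmxBl XD YD subrr.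
Qed.

Lemma interpolation (s : seq R) (g : R -> R) :
  exists p : {poly R}, {in s, forall x, p.[x] = g x}.
Proof.
elim: s => [|x s [p ps]]; first by exists 0.
have [xs|xs] := boolP (x \in s).
  by exists p => y; rewrite inE => /orP[/eqP->|]; exact: ps.
pose r := \prod_(y <- s) ('X - y%:P).
have rx : r.[x] != 0.
  by move: xs; rewrite -root_prod_XsubC rootE.
exists (p + ((g x - p.[x]) / r.[x]) *: r) => y; rewrite inE => /orP[/eqP->|ys].
  by rewrite hornerD hornerZ divfK // addrC subrK.
have /eqP ry : r.[y] == 0 by rewrite -rootE root_prod_XsubC.
by rewrite hornerD hornerZ ry mulr0 addr0 ps.
Qed.

End Quad.

(** * Positive semidefinite square roots *)

Section Root.
Context {R : realType}.

Local Notation C := (complex R).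
Local Notation toC := (real_complex R).

Lemma psd1 n : psd (1%:M : 'M[R]_n).
Proof.
split=> [|x]; first exact: trmx1.
by rewrite /quad mulmx1 mxE; apply: sumr_ge0 => i _; rewrite mxE -expr2 sqr_ge0.
Qed.

Lemma psd0 n : psd (0 : 'M[R]_n).
Proof. by split=> [|x]; rewrite ?linear0 // /quad mulmx0 mul0mx mxE. Qed.

Lemma horner_mx_sym n (M : 'M[R]_n.+1) (p : {poly R}) :
  M^T = M -> (horner_mx M p)^T = horner_mx M p.
Proof.
move=> sM; elim/poly_ind: p => [|p c IH]; first by rewrite rmorph0 trmx0.
rewrite rmorphD rmorphM /= horner_mx_X horner_mx_C linearD /= tr_scalar_mx.
rewrite trmx_mul IH sM; congr (_ + _).
exact: (comm_mx_horner p (comm_mx_refl M)).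
Qed.

(** The spectral theorem for the complexification of [M]; each eigenvalue is the value of
   the form of [M] at the real part of an eigenvector plus that at the imaginary part,
   hence real and nonnegative. *)
Lemma psd_eigen n (M : 'M[R]_n) : psd M ->
  exists (U : 'M[C]_n) (d : 'rV[R]_n), [/\ U \in unitmx,
    map_mx toC M = invmx U *m diag_mx (map_mx toC d) *m U &
    forall i, 0 <= d 0 i].
Proof.
move=> [sM pM]; pose MC := map_mx toC M.
have rMC : MC \is a realmx.
  by apply/mxOverP => i j; rewrite mxE complex_real.
have hM : MC \is hermsymmx.
  apply: realsym_hermsym => //; apply/is_hermitianmxP.
  by rewrite expr0 scale1r map_mx_id // /MC map_trmx sM.
have /orthomx_spectralP E := hermitian_normalmx hM.
have /mxOverP rD := hermitian_spectral_diag_real hM.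
set U := spectralmx MC in E *; set D := spectral_diag MC in E rD *.
pose d := map_mx (@complex.Re R) D.
have dD : map_mx toC d = D.
  by apply/matrixP => i j; rewrite !mxE RRe_real.
exists U, d; split; [exact: spectral_unit | by rewrite dD | ].
move=> i; rewrite mxE.
have uU : U \is unitarymx by exact: spectral_unitarymx.
have -> : D 0 i = \sum_k \sum_j U i j * (M j k)%:C%C * (U i k)^*%C.
  have -> : D 0 i = (U *m MC *m invmx U) i i.
    rewrite E -mulmxA mulmxK ?spectral_unit // mulKVmx ?spectral_unit //.
    by rewrite mxE eqxx mulr1n.
  rewrite invmx_unitary // mxE; apply: eq_bigr => k _.
  rewrite !mxE mulr_suml; apply: eq_bigr => j _.
  by rewrite mxE.
have := pM (\col_j complex.Re (U i j)); have := pM (\col_j complex.Im (U i j)).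
rewrite !quad_sum => h1 h2; have := addr_ge0 h2 h1.
move=> /le_trans; apply; rewrite le_eqVlt; apply/orP; left; apply/eqP.
rewrite [in RHS]exchange_big /= -big_split /=.
rewrite (big_morph (@complex.Re R) (id1 := 0) (op1 := +%R)) //; last by case=> ? ? [].
apply: eq_bigr => k _; rewrite -big_split /=.
rewrite (big_morph (@complex.Re R) (id1 := 0) (op1 := +%R)) //; last by case=> ? ? [].
apply: eq_bigr => j _; rewrite !mxE.
by case: (U i j) => a b; case: (U i k) => c e /=; ring.
Qed.
(** The root is a polynomial in [M], found by interpolating the fourth root at
   the eigenvalues; being the square of a symmetric matrix, it is positive
   semidefinite. *)
Lemma psd_root_exists n (M : 'M[R]_n) : psd M -> exists T, psd T /\ T *m T = M.
Proof.
case: n M => [|n] M pM; first by exists M; split; rewrite // [LHS]flatmx0 [RHS]flatmx0.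
have [U [d [uU E d0]]] := psd_eigen pM.
have [p ps] := interpolation [seq d 0 i | i <- enum 'I_n.+1]
  (fun x => Num.sqrt (Num.sqrt x)).
have pd i : p.[d 0 i] ^+ 4 = d 0 i.
  by rewrite ps ?map_f ?mem_enum // (exprM _ 2 2) !sqr_sqrtr ?sqrtr_ge0.
pose r := horner_mx M p; have sr : r^T = r by exact/horner_mx_sym/pM.1.
exists (r *m r); split.
  have := @psd_congr R n.+1 n.+1 1%:M r; rewrite sr mulmx1; apply.
  exact: psd1.
have -> : r *m r *m (r *m r) = horner_mx M (p ^+ 4).
  by rewrite rmorphXn /= !exprS expr0 mulr1 -!mulmxE !mulmxA.
apply: (map_mx_inj (f := toC)); rewrite /= map_horner_mx /= E.
rewrite horner_mx_uconjC ?qualifE //= horner_mx_diag; congr (_ *m diag_mx _ *m _).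
by apply/matrixP => i j; rewrite !mxE horner_map /= horner_exp ord1 pd.
Qed.

Lemma sqrtmP n (M : 'M[R]_n) : psd M -> psd (sqrtm M) /\ sqrtm M *m sqrtm M = M.
Proof.
by move=> pM; have [T hT] := psd_root_exists pM; exact: (xgetI (P := [set S | psd S /\ S *m S = M]) 0 hT).
Qed.

Lemma sqrtm_sqr n (M : 'M[R]_n) : psd M -> sqrtm (M *m M) = M.
Proof.
move=> pM; have p2 : psd (M *m M).
  have := @psd_congr R n n 1%:M M; rewrite pM.1 mulmx1; apply.
  exact: psd1.
by have [pT ET] := sqrtmP p2; apply: psd_root_unique.
Qed.

Lemma sqrtm0 n : sqrtm (0 : 'M[R]_n) = 0.
Proof. by rewrite -{1}(mulmx0 n (0 : 'M[R]_n)) sqrtm_sqr //; exact: psd0. Qed.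

Lemma gelbrich_ball_center q (eps : R) (Sh : 'M[R]_q) : 0 <= eps -> psd Sh ->
  gelbrich_ball (eps, Sh) Sh.
Proof.
move=> e0 pS; split=> //=; have [pT ET] := sqrtmP pS.
have -> : sqrtm Sh *m Sh *m sqrtm Sh = Sh *m Sh.
  by rewrite -[in X in _ *m X *m _]ET -!mulmxA ET !mulmxA ET.
by rewrite sqrtm_sqr // scaler_nat mulr2n subrr linear0 sqr_ge0.
Qed.

Lemma gelbrich_ball0 q (S : 'M[R]_q) : gelbrich_ball (0, 0) S -> S = 0.
Proof.
move=> [pS] /=; rewrite sqrtm0 !mul0mx sqrtm0.
rewrite scaler0 subr0 add0r expr0n /= => t0.
by apply: psd_tr0 => //; apply/eqP; rewrite eq_le t0 tr_psd_ge0.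
Qed.

(** * The Riccati equation *)

Section Riccati.
Context {n m q : nat} (S : mpc R n m q).
Hypotheses (pQ : psd (wgtQ S)) (pR : pd (wgtR S)) (pP : psd (wgtP S)).
Hypothesis ric : riccati S.

Definition wgtS {R : realType} {n m q : nat} (S : mpc R n m q) :=
  wgtR S + (sysB S)^T *m wgtP S *m sysB S.

Lemma wgtS_pd : pd (wgtS S).
Proof. exact: (pd_psdD pR (psd_congr _ pP)). Qed.

Lemma stage_riccati x u :
  stage S x u + quad (wgtP S) (sysA S *m x + sysB S *m u) =
  quad (wgtP S) x + quad (wgtS S) (u - gainK S *m x).
Proof.
have uS := pd_unit wgtS_pd; have sS := wgtS_pd.1; have sP := pP.1.
have sK : wgtS S *m gainK S = - ((sysB S)^T *m wgtP S *m sysA S).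
  by rewrite /gainK -/(wgtS S) mulmxN !mulmxA mulmxV // mul1mx.
have -> : quad (wgtP S) x = quad (wgtQ S) x + quad (wgtP S) (sysA S *m x)
    - quad (wgtS S) (gainK S *m x).
  rewrite {1}ric -/(wgtS S) quadDm quadDm quadNm quad_mul.
  rewrite [quad (wgtS S) _]quad_mul -(mulmxA _ (wgtS S)) sK mulmxN quadNm opprK /gainK -/(wgtS S).
  rewrite linearN /= mulNmx quadNm !trmx_mul trmx_inv sS sP !trmxK !mulmxA; ring.
have bK : bil (wgtS S) u (gainK S *m x) = - bil (wgtP S) (sysA S *m x) (sysB S *m u).
  by rewrite bil_mulr sK bilNm -bil_mulr -bil_mull bilC.
rewrite /stage -(scaleN1r (gainK S *m x)) (quadD _ _ sP) (quadD _ _ sS) quadZ bilZr.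
rewrite bK {2}/wgtS (quadDm (wgtR S)) -quad_mul; ring.
Qed.

(** The Riccati equation completes the square: along one step the stage cost
   is the decrease of the terminal cost, plus the price of not playing the gain,
   plus terms in the noise. *)
Lemma stage_step x u w :
  stage S x u = quad (wgtP S) x
    - quad (wgtP S) (sysA S *m x + sysB S *m u + sysG S *m w)
    + quad (wgtS S) (u - gainK S *m x)
    + 2 * bil (wgtP S) (sysA S *m x + sysB S *m u) (sysG S *m w)
    + quad (wgtP S) (sysG S *m w).
Proof. rewrite (quadD _ (sysG S *m w) pP.1); have := stage_riccati x u; lra. Qed.

Lemma wgtS_ge0 u : 0 <= quad (wgtS S) u.
Proof. exact: (pd_psd wgtS_pd).2. Qed.

Lemma stage_ge0 x u : 0 <= stage S x u.
Proof. by rewrite addr_ge0 // ?pQ.2 // (pd_psd pR).2. Qed.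

End Riccati.
End Root.

(** * Almost surely bounded random variables *)

Section Law.
Context {d1 d2} {T1 : measurableType d1} {T2 : measurableType d2} {R : realType}.

Definition law (P : probability T1 R) (X : T1 -> T2) (mX : measurable_fun setT X)
    : probability T2 R :=
  distribution P (HB.pack X (isMeasurableFun.Build _ _ _ _ X mX) : {mfun T1 >-> T2}).

Lemma lawE P X mX A : @law P X mX A = P (X @^-1` A).
Proof. by []. Qed.

End Law.

Section AsBounded.
Context {d} {T : measurableType d} {R : realType} (P : probability T R).
Implicit Types f g : T -> R.

Lemma ae_mono (A B : T -> Prop) : (forall w, A w -> B w) ->
  {ae P, forall w, A w} -> {ae P, forall w, B w}.
Proof. exact: filterS. Qed.

Lemma ae_forall_nat (A : nat -> T -> Prop) :
  (forall i, {ae P, forall w, A i w}) -> {ae P, forall w, forall i, A i w}.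
Proof. by move=> h; apply/ae_foralln. Qed.

Lemma ae_forall_ord N (A : 'I_N -> T -> Prop) :
  (forall i, {ae P, forall w, A i w}) -> {ae P, forall w, forall i, A i w}.
Proof.
move=> h; have := @ae_forall_nat (fun i w => if insub i is Some j then A j w else True).
move=> /(_ _)/ae_mono; apply=> [w H i|i]; first by have := H i; rewrite valK.
by case: insubP => [j _ _|_]; [exact: h | exact: aeW].
Qed.

(** Random variables of this class are integrable, and the class is closed
   under sums and products. *)
Definition asbounded f :=
  measurable_fun setT f /\ exists C : R, {ae P, forall w, `|f w| <= C}.

Definition mean f : R := fine (\int[P]_w (f w)%:E)%E.

Lemma asbounded_bound f : asbounded f ->
  exists2 C : R, 0 <= C & {ae P, forall w, `|f w| <= C}.
Proof.
move=> [_ [C h]]; exists `|C| => //; apply: filterS h => w /le_trans; apply.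
exact: ler_norm.
Qed.

Lemma asbounded_integrable f : asbounded f -> P.-integrable setT (EFin \o f).
Proof.
move=> bf; have mf := bf.1; have [C C0 h] := asbounded_bound bf.
apply/integrableP; split; first exact/measurable_EFinP.
apply: (@le_lt_trans _ _ (\int[P]_w (cst C%:E w))%E).
  apply: ae_ge0_le_integral => //; last by apply: filterS h => w h _; rewrite lee_fin.
  by apply: measurableT_comp => //; exact/measurable_EFinP.
by rewrite integral_cst //= probability_setT mule1 ltry.
Qed.

Lemma meanE f : asbounded f -> (\int[P]_w (f w)%:E = (mean f)%:E)%E.
Proof.
by move=> /asbounded_integrable bf; rewrite /mean fineK // integrable_fin_num.
Qed.

Lemma expectation_mean f : asbounded f -> ('E_P[f] = (mean f)%:E)%E.
Proof. by move=> bf; rewrite unlock meanE. Qed.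

Lemma asbounded_cst c : asbounded (cst c).
Proof.
by split; [exact: measurable_cst | exists `|c|; apply: aeW => w /=].
Qed.

Lemma asboundedD f g : asbounded f -> asbounded g -> asbounded (f \+ g).
Proof.
move=> [mf [C Cf]] [mg [D Dg]]; split; first exact: measurable_funD.
exists (C + D); apply: filterS2 Cf Dg => w Cf Dg.
by rewrite (le_trans (ler_normD _ _)) // lerD.
Qed.

Lemma asboundedM f g : asbounded f -> asbounded g -> asbounded (f \* g).
Proof.
move=> [mf [C Cf]] [mg [D Dg]]; split; first exact: measurable_funM.
exists (C * D); apply: filterS2 Cf Dg => w Cf Dg.
by rewrite normrM ler_pM.
Qed.

Lemma asboundedZ c f : asbounded f -> asbounded (fun w => c * f w).
Proof. by move=> bf; exact: (asboundedM (asbounded_cst c) bf). Qed.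

Lemma asboundedN f : asbounded f -> asbounded (fun w => - f w).
Proof.
by move=> /(asboundedZ (-1)); under eq_fun do rewrite mulN1r.
Qed.

Lemma asboundedB f g : asbounded f -> asbounded g -> asbounded (fun w => f w - g w).
Proof. by move=> bf /asboundedN; exact: asboundedD. Qed.

Lemma asbounded_sum (I : Type) (s : seq I) (Q : pred I) (f : I -> T -> R) :
  (forall i, Q i -> asbounded (f i)) ->
  asbounded (fun w => \sum_(i <- s | Q i) f i w).
Proof.
move=> bf; elim: s => [|i s IH].
  by under eq_fun do rewrite big_nil; exact: asbounded_cst.
have [Qi|/negPf Qi] := boolP (Q i); under eq_fun do rewrite big_cons Qi; last exact: IH.
by apply: asboundedD => //; exact: bf.
Qed.

Lemma mean_cst c : mean (cst c) = c.
Proof. by have := expectation_cst P c; rewrite /mean unlock => ->. Qed.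

Lemma meanD f g : asbounded f -> asbounded g ->
  mean (fun w => f w + g w) = mean f + mean g.
Proof.
move=> bf bg; apply: EFin_inj; rewrite -meanE; last exact: asboundedD.
rewrite EFinD -!meanE // -integralD_EFin //; exact: asbounded_integrable.
Qed.

Lemma meanZ c f : asbounded f -> mean (fun w => c * f w) = c * mean f.
Proof.
move=> bf; apply: EFin_inj; rewrite -meanE; last exact: asboundedZ.
rewrite EFinM -meanE // -integralZl //; exact: asbounded_integrable.
Qed.

Lemma meanN f : asbounded f -> mean (fun w => - f w) = - mean f.
Proof. by move=> /(meanZ (-1)); under eq_fun do rewrite mulN1r; rewrite mulN1r. Qed.

Lemma meanB f g : asbounded f -> asbounded g ->
  mean (fun w => f w - g w) = mean f - mean g.
Proof. by move=> bf bg; rewrite meanD ?meanN //; exact: asboundedN. Qed.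

Lemma mean_sum (I : Type) (s : seq I) (Q : pred I) (f : I -> T -> R) :
  (forall i, Q i -> asbounded (f i)) ->
  mean (fun w => \sum_(i <- s | Q i) f i w) = \sum_(i <- s | Q i) mean (f i).
Proof.
move=> bf; elim: s => [|i s IH].
  by under eq_fun do rewrite big_nil; rewrite big_nil mean_cst.
rewrite big_cons -IH.
have [Qi|/negPf Qi] := boolP (Q i); under eq_fun do rewrite big_cons Qi; last by [].
by rewrite meanD ?bf //; [exact: bf | exact: asbounded_sum].
Qed.

Lemma mean_le f g : asbounded f -> asbounded g ->
  {ae P, forall w, f w <= g w} -> mean f <= mean g.
Proof.
move=> bf bg fg; rewrite -subr_ge0 -meanB // -lee_fin -meanE; last exact: asboundedB.
have bgf := asboundedB bg bf.
have E : (\int[P]_w (g w - f w)%:E = \int[P]_w `|(g w - f w)%:E|)%E.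
  apply: ae_eq_integral => //.
  - exact/measurable_EFinP/bgf.1.
  - by apply: measurableT_comp => //; exact/measurable_EFinP/bgf.1.
  by apply: filterS fg => w fg _; rewrite /= ger0_norm // subr_ge0.
by rewrite E; apply: integral_ge0.
Qed.

Lemma mean_ae_eq f g : asbounded f -> asbounded g ->
  {ae P, forall w, f w = g w} -> mean f = mean g.
Proof.
move=> bf bg fg; apply/eqP; rewrite eq_le.
by apply/andP; split; apply: mean_le => //; apply: filterS fg => w ->.
Qed.

Lemma mean_bound f C : asbounded f -> {ae P, forall w, f w <= C} -> mean f <= C.
Proof.
move=> bf fC; rewrite -[leRHS]mean_cst; apply: mean_le => //.
exact: asbounded_cst.
Qed.

Lemma mean_ge f C : asbounded f -> {ae P, forall w, C <= f w} -> C <= mean f.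
Proof.
move=> bf fC; rewrite -[leLHS]mean_cst; apply: mean_le => //.
exact: asbounded_cst.
Qed.

Lemma asbounded_indic A : measurable A -> asbounded (\1_A : T -> R).
Proof.
move=> mA; split; first exact: measurable_indic.
exists 1; apply: aeW => w; rewrite indicE.
by case: (_ \in _); rewrite ?normr1 // normr0.
Qed.

Lemma mean_indic A : measurable A -> mean (\1_A : T -> R) = fine (P A).
Proof. by move=> mA; rewrite /mean integral_indic // setIT. Qed.

End AsBounded.

Section AsBoundedLaw.
Context {d1 d2} {T1 : measurableType d1} {T2 : measurableType d2} {R : realType}.
Context (P : probability T1 R) (X : T1 -> T2) (mX : measurable_fun setT X).

Lemma ae_law (Q : T2 -> Prop) :
  {ae law P mX, forall y, Q y} -> {ae P, forall w, Q (X w)}.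
Proof.
move=> [N [mN N0 QN]]; exists (X @^-1` N); split.
- by rewrite -[X in measurable X]setTI; exact: mX.
- exact: N0.
- by move=> w /= h; apply: QN.
Qed.

Lemma asbounded_law (f : T2 -> R) :
  asbounded (law P mX) f -> asbounded P (f \o X).
Proof.
move=> [mf [C h]]; split; first exact: measurableT_comp.
by exists C; exact: (ae_law h).
Qed.

Lemma asbounded_lawI (f : T2 -> R) : measurable_fun setT f ->
  asbounded P (f \o X) -> asbounded (law P mX) f.
Proof.
move=> mf [mfX [C [N [mN N0 hN]]]]; split => //; exists C.
have mA : measurable [set y | ~ (`|f y| <= C)].
  have -> : [set y | ~ `|f y| <= C] = setT `&` (fun y => `|f y|) @^-1` `]C, +oo[.
    apply/seteqP; split => y /=; rewrite in_itv /= andbT ltNge.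
      by move/negP.
    by case=> _ /negP.
  by apply: (measurableT_comp _ mf).
exists [set y | ~ (`|f y| <= C)]; split => //.
apply: (subset_measure0 _ mN _ N0) => //.
by rewrite -[X in measurable X]setTI; exact: mX.
Qed.

Lemma mean_law (f : T2 -> R) :
  asbounded (law P mX) f -> mean (law P mX) f = mean P (f \o X).
Proof.
move=> bf; have bfX := asbounded_law bf; rewrite /mean; congr fine.
rewrite integral_pushforward ?preimage_setT //.
- exact/measurable_EFinP/bf.1.
- exact: (asbounded_integrable bfX).
Qed.

End AsBoundedLaw.

Section Independence.
Context {d d1 d2} {T : measurableType d} {T1 : measurableType d1}
  {T2 : measurableType d2} {R : realType}.
Context (P : probability T R) (X : T -> T1) (Y : T -> T2).
Hypotheses (mX : measurable_fun setT X) (mY : measurable_fun setT Y).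
Hypothesis XY : forall A B, measurable A -> measurable B ->
  (P (X @^-1` A `&` Y @^-1` B) = P (X @^-1` A) * P (Y @^-1` B))%E.

(** The joint distribution is the product of the marginal ones, and Fubini's theorem
   applies. *)
Lemma mean_indep (f : T1 -> R) (g : T2 -> R) :
  measurable_fun setT f -> measurable_fun setT g ->
  asbounded P (f \o X) -> asbounded P (g \o Y) ->
  mean P (fun w => f (X w) * g (Y w)) = mean P (f \o X) * mean P (g \o Y).
Proof.
move=> mf mg bf bg; have mXY := measurable_fun_pair mX mY.
pose h (z : T1 * T2) := (f z.1 * g z.2)%:E.
have mh : measurable_fun setT h.
  apply/measurable_EFinP/measurable_funM.
    exact: (measurableT_comp mf measurable_fst).
  exact: (measurableT_comp mg measurable_snd).
have ih : P.-integrable setT (h \o (fun w => (X w, Y w))).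
  exact: (asbounded_integrable (asboundedM bf bg)).
have E : forall A, measurable A -> A `<=` setT ->
    law P mXY A = (law P mX \x law P mY)%E A.
  move=> A mA _; rewrite (product_measure_unique (m' := law P mXY)) //.
have il : (law P mX \x law P mY)%E.-integrable setT h.
  have /integrableP[_ lt] := integrable_pushforward mXY mh ih measurableT.
  apply/integrableP; split => //.
  by rewrite -(eq_measure_integral _ E).
rewrite {1}/mean (_ : (\int[P]_w _)%E =
    (\int[law P mXY]_z h z)%E); last first.
  by rewrite integral_pushforward.
rewrite (eq_measure_integral _ E) -integral12_prod_meas1 // /fubini_F.
have bf' := asbounded_lawI mX mf bf; have bg' := asbounded_lawI mY mg bg.
rewrite -(mean_law (mX := mX)) // -(mean_law (mX := mY)) //.
have inner x : (\int[law P mY]_y h (x, y) = (mean (law P mY) g * f x)%:E)%E.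
  rewrite /h /= (eq_integral (fun y => (f x)%:E * (g y)%:E)%E) // integralZl //.
    by rewrite meanE // -EFinM mulrC.
  exact: asbounded_integrable.
under eq_integral do rewrite inner.
by have := meanE (asboundedZ (mean (law P mY) g) bf') => ->; rewrite meanZ //= mulrC.
Qed.

End Independence.

(** * Borel vectors *)

Section BorelVectors.
Context {R : realType}.

Lemma open_measurable_vecB n (U : set 'cV[R]_n) :
  open U -> measurable (U : set (vecB R n)).
Proof. by move=> oU; exact: sub_sigma_algebra. Qed.

Lemma closed_measurable_vecB n (U : set 'cV[R]_n) :
  closed U -> measurable (U : set (vecB R n)).
Proof.
move=> cU; rewrite -[X in measurable X]setCK; apply: measurableC.
by apply: open_measurable_vecB; exact: closed_openC.
Qed.

Lemma measurable_coord n (i : 'I_n) :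
  measurable_fun setT (fun x : vecB R n => (x : 'cV[R]_n) i 0).
Proof.
apply: (measurability _ (RGenOpens.measurableE R)) => _ [U [a [b ->]] <-].
rewrite setTI; apply: open_measurable_vecB.
apply: open_comp; last exact: interval_open.
by move=> x _; exact: coord_continuous.
Qed.

Section IntoVectors.
Context {d} {T : measurableType d}.

(** The open sets of a finite-dimensional space are countable unions of
   rational boxes, so that the Borel sets are generated by the coordinates. *)
Lemma measurable_vecP n (f : T -> 'cV[R]_n) :
  measurable_fun setT (f : T -> vecB R n) <->
  forall i, measurable_fun setT (fun t => f t i 0).
Proof.
split=> [mf i|mf]; first exact: (measurableT_comp (measurable_coord i) mf).
apply: (@measurability _ _ T (vecB R n) setT f (@open 'cV[R]_n) erefl).
move=> _ [U oU <-]; rewrite setTI.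
pose box (cr : 'cV[rat]_n * rat) :=
  [set x : 'cV[R]_n | forall i, `|ratr (cr.1 i 0) - x i 0| < ratr cr.2].
have -> : f @^-1` U = \bigcup_cr
    (if `[< box cr `<=` U >] then f @^-1` box cr else set0).
  apply/seteqP; split => t /=; last first.
    by case=> cr _; case: asboolP => // sU; exact: sU.
  move=> Ut; have /(nbhs_ballP (f t))[e /= e0 sU] : nbhs (f t) U by exact: open_nbhs_nbhs.
  have [r] := @rat_in_itvoo R 0 (e / 2) ltac:(by rewrite divr_gt0).
  rewrite in_itv /= => /andP[r0 re].
  have h i : exists c : rat, `|ratr c - f t i 0| < ratr r.
    have [c] := @rat_in_itvoo R (f t i 0 - ratr r) (f t i 0 + ratr r) ltac:(lra).
    by rewrite in_itv /= => hc; exists c; rewrite ltr_distl.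
  pose c : 'cV[rat]_n := \col_i sval (cid (h i)).
  have bt : box (c, r) (f t) by move=> i; rewrite mxE; case: cid.
  exists (c, r) => //; case: asboolP => // -[] y yb; apply: sU; split => // i j.
  rewrite ord1 /ball /=; have := bt i; have := yb i.
  rewrite !ltr_distl /= => /andP[h1 h2] /andP[h3 h4]; apply/andP; split; lra.
apply: countable_bigcupT_measurable => [|cr]; first exact: countableP.
case: ifP => // _.
have -> : f @^-1` box cr = \bigcap_(i in [set: 'I_n])
    [set t | `|ratr (cr.1 i 0) - f t i 0| < ratr cr.2].
  by apply/seteqP; split => t /= h i; [move=> _|]; exact: h.
apply: fin_bigcap_measurable => // i _.
have -> : [set t | `|ratr (cr.1 i 0) - f t i 0| < ratr cr.2] =
   (fun t => `|ratr (cr.1 i 0) - f t i 0|) @^-1` `]-oo, ratr cr.2[.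
  by apply/seteqP; split => t /=; rewrite in_itv.
have mg : measurable_fun setT (fun t => `|ratr (cr.1 i 0) - f t i 0|).
  by apply: measurableT_comp => //; apply: measurable_funB.
by rewrite -[X in measurable X]setTI; apply: mg.
Qed.

Lemma measurable_vecD n (f g : T -> 'cV[R]_n) :
  measurable_fun setT (f : T -> vecB R n) ->
  measurable_fun setT (g : T -> vecB R n) ->
  measurable_fun setT ((fun t => f t + g t) : T -> vecB R n).
Proof.
move=> /measurable_vecP mf /measurable_vecP mg; apply/measurable_vecP => i.
by under eq_fun do rewrite mxE; exact: measurable_funD.
Qed.

Lemma measurable_vec_mul n p (A : 'M[R]_(p, n)) (f : T -> 'cV[R]_n) :
  measurable_fun setT (f : T -> vecB R n) ->
  measurable_fun setT ((fun t => A *m f t) : T -> vecB R p).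
Proof.
move=> /measurable_vecP mf; apply/measurable_vecP => i.
under eq_fun do rewrite mxE; apply: measurable_sum => j.
exact: measurable_funM.
Qed.

Lemma measurable_bil n p (M : 'M[R]_(n, p)) (f : T -> 'cV[R]_n) (g : T -> 'cV[R]_p) :
  measurable_fun setT (f : T -> vecB R n) ->
  measurable_fun setT (g : T -> vecB R p) ->
  measurable_fun setT (fun t => bil M (f t) (g t)).
Proof.
move=> /measurable_vecP mf /measurable_vecP mg.
under eq_fun do rewrite bil_sum.
do 2 apply: measurable_sum => ?; apply: measurable_funM => //.
exact: measurable_funM.
Qed.

End IntoVectors.

(** * Families of Borel vectors *)

Section Families.
Context {I : choiceType} {n : nat}.
Local Notation fam := (famB I R n).

Lemma measurable_fam_coord (i : I) :
  measurable_fun setT (fun w : fam => w i : vecB R n).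
Proof.
move=> _ B mB; rewrite setTI; apply: sub_sigma_algebra.
by exists i => //; exists B => //; rewrite setTI.
Qed.

Lemma measurable_famP {d} {T : measurableType d} (f : T -> fam) :
  (forall i, measurable_fun setT (fun t => f t i : vecB R n)) ->
  measurable_fun setT f.
Proof.
move=> mf; apply: (@measurability _ _ T fam setT f (@cylinders I R n) erefl).
move=> _ [_ [i _ [B mB <-]] <-].
by rewrite !setTI; have := mf i measurableT B mB; rewrite setTI.
Qed.

Lemma measurable_box (s : seq I) (B : I -> set (vecB R n)) :
  (forall i, measurable (B i)) ->
  measurable [set w : fam | forall i, i \in s -> B i (w i)].
Proof.
move=> mB; have -> : [set w : fam | forall i, i \in s -> B i (w i)] =
    \bigcap_(i in [set` s]) [set w : fam | B i (w i)].
  by apply/seteqP; split => w h i; exact: h.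
apply: fin_bigcap_measurable => // i _.
by rewrite -[X in measurable X]setTI; exact: (measurable_fam_coord i).
Qed.

(** The finite boxes are a generating pi-system. *)
Lemma fam_measure_unique (m1 m2 : {measure set fam -> \bar R}) :
  (m1 setT < +oo)%E ->
  (forall (s : seq I) (B : I -> set (vecB R n)), uniq s -> (forall i, measurable (B i)) ->
    m1 [set w | forall i, i \in s -> B i (w i)] =
    m2 [set w | forall i, i \in s -> B i (w i)]) ->
  forall A, measurable A -> m1 A = m2 A.
Proof.
move=> m1fin m12.
pose G : set (set fam) := [set E | exists s (B : I -> set (vecB R n)),
  [/\ uniq s, (forall i, measurable (B i)) &
   E = [set w | forall i, i \in s -> B i (w i)]]].
have GT : G setT.
  exists [::], (fun=> setT); split => //.
  by apply/seteqP; split.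
apply: (@measure_unique _ _ _ G (fun=> setT)) => //.
- apply/seteqP; split; last first.
    by apply: smallest_sub => [|_ [s [B [_ mB ->]]]];
      [exact: sigma_algebra_measurable | exact: measurable_box].
  apply: sub_smallest2r => // _ [i _ [B mB <-]].
  exists [:: i], (fun=> B); split => //.
  apply/seteqP; split => w /=.
    by move=> [_ h] j; rewrite inE => /eqP->.
  by move=> h; split=> //; apply: h; rewrite inE.
- move=> _ _ [s [B [us mB ->]]] [t [C [ut mC ->]]].
  exists (undup (s ++ t)), (fun i => (if i \in s then B i else setT) `&`
    (if i \in t then C i else setT)); split; first exact: undup_uniq.
    by move=> i; apply: measurableI; case: ifP.
  apply/seteqP; split => w /=.
    by move=> [h1 h2] i _; split; case: ifP => // hi; [exact: h1|exact: h2].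
  move=> h; split => i hi.
    by have := h i; rewrite mem_undup mem_cat hi => -[].
  by have := h i; rewrite mem_undup mem_cat hi orbT => -[].
- by rewrite bigcup_const //; exists 0%N.
- by move=> _ [s [B [us mB ->]]]; exact: m12.
Qed.

End Families.
End BorelVectors.

(** The sequence with its terms from time [i] on erased; the measurable functions of
   [past i w] are those of the noise before time [i]. *)
Definition past {R : realType} {q : nat} (i : nat) (w : nat -> 'cV[R]_q) (j : nat) :
    'cV[R]_q :=
  if (j < i)%N then w j else 0.

Section Past.
Context {R : realType} {q : nat}.
Local Notation fam := (famB nat R q).

Lemma measurable_past i : measurable_fun setT (past i : fam -> fam).
Proof.
apply: measurable_famP => j; rewrite /past; case: (j < i)%N.
  exact: measurable_fam_coord.
exact: measurable_cst.
Qed.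

Context (P : probability fam R) (iP : indep_coord P).

Lemma measurable_coord_preimage (i : nat) (B : set (vecB R q)) : measurable B ->
  measurable [set w : fam | B (w i)].
Proof.
by move=> mB; rewrite -[X in measurable X]setTI; exact: measurable_fam_coord.
Qed.

(** Both sides are finite measures in [A], and they agree on boxes, of which the
   coordinates from [i] on only test whether [0] belongs to the sides. *)
Lemma past_indep i (A : set fam) (B : set (vecB R q)) :
  measurable A -> measurable B ->
  (P (past i @^-1` A `&` [set w : fam | B (w i)]) =
   P (past i @^-1` A) * P [set w : fam | B (w i)])%E.
Proof.
move=> mA mB; have mBi := measurable_coord_preimage i mB.
pose c : {nonneg R} := NngNum (fine_ge0 (measure_ge0 P [set w : fam | B (w i)])).
have cE : (c%:num%:E = P [set w : fam | B (w i)])%E.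
  by rewrite /= fineK // fin_num_measure.
pose f : {mfun fam >-> fam} := HB.pack (past i : fam -> fam)
  (isMeasurableFun.Build _ _ _ _ (past i : fam -> fam) (measurable_past i)).
have E := @fam_measure_unique R nat q (pushforward (mrestr P mBi) f)
  (mscale c (distribution P f)) _ _ A mA.
rewrite muleC; move: E; rewrite /distribution /= /mscale /pushforward /mrestr cE.
move=> E; refine (E (measurable_past i) _ _) => [|s C us mC].
  by rewrite preimage_setT setTI -ge0_fin_numE // fin_num_measure.
change (P (past i @^-1` [set w | forall j, j \in s -> C j (w j)] `&` [set w | B (w i)]) =
  P [set w : fam | B (w i)] * P (past i @^-1` [set w | forall j, j \in s -> C j (w j)]))%E.
pose t := [seq j <- s | (j < i)%N].
have [C0|] := pselect (forall j, j \in s -> (i <= j)%N -> C j 0); last first.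
  move=> nC; suff -> : past i @^-1` [set w | forall j, j \in s -> C j (w j)] = set0.
    by rewrite set0I measure0 mule0.
  apply/seteqP; split => // w /= h; apply: nC => j js ij.
  by have := h j js; rewrite /past ltnNge ij.
have -> : past i @^-1` [set w | forall j, j \in s -> C j (w j)] =
    [set w | forall j, j \in t -> C j (w j)].
  apply/seteqP; split => w /= h j.
    by rewrite mem_filter => /andP[ji /h]; rewrite /past ji.
  rewrite /past; case: ltnP => ji js; last exact: C0.
  by apply: h; rewrite mem_filter ji.
have it : i \notin t by rewrite mem_filter ltnn.
have ut : uniq t by exact: filter_uniq.
pose D j := if j == i then B else C j.
have mD j : measurable (D j) by rewrite /D; case: eqP.
have -> : [set w | forall j, j \in t -> C j (w j)] `&` [set w | B (w i)] =
    [set w : fam | forall j, j \in i :: t -> D j (w j)].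
  apply/seteqP; split => w /=.
    move=> [h1 h2] j; rewrite inE /D; have [->//|_ /=] := eqVneq j i.
    exact: h1.
  move=> h; split=> [j jt|]; last by have := h i; rewrite /D eqxx inE eqxx; apply.
  have := h j; rewrite /D inE jt orbT => /(_ isT).
  by case: eqP it => [<-|//]; rewrite jt.
rewrite iP //=; last by rewrite it.
rewrite iP // big_cons; congr (_ * _)%E; first by rewrite /D eqxx.
rewrite !big_seq; apply: eq_bigr => j jt; rewrite /D.
by case: eqP it => [<-|//]; rewrite jt.
Qed.

End Past.

(** * Products of probability measures *)

Section Product.
Context {R : realType} {q : nat} (mu : probability (vecB R q) R).
Local Notation fam := (famB nat R q).

(** The coordinates are drawn one after the other, so that binary products suffice; those
   that have not been drawn are zero. *)
Lemma product_prefix (k : nat) : exists P : probability fam R,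
  forall B : nat -> set (vecB R q), (forall i, measurable (B i)) ->
  (P [set w | forall i, (i < k)%N -> B i (w i)] = \prod_(i < k) mu (B i))%E.
Proof.
elim: k => [|k [P hP]].
  exists (law (\d_(0 : vecB R q)) (measurable_cst ((fun=> 0) : fam))) => B mB.
  rewrite big_ord0 (_ : [set w | _] = setT) ?probability_setT //.
  by apply/seteqP; split.
pose f (z : fam * vecB R q) : fam := fun i => if i == k then z.2 else z.1 i.
have mf : measurable_fun setT f.
  apply: measurable_famP => i; rewrite /f; case: (i == k); first exact: measurable_snd.
  have mi : measurable_fun setT (fun w : fam => w i : vecB R q).
    exact: measurable_fam_coord.
  exact: (measurableT_comp mi measurable_fst).
exists (law (P \x mu)%E mf) => B mB; rewrite lawE.
have -> : f @^-1` [set w | forall i, (i < k.+1)%N -> B i (w i)] =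
    [set w | forall i, (i < k)%N -> B i (w i)] `*` B k.
  apply/seteqP; split => -[w z] /=.
    move=> h; split; last by have := h k (ltnSn k); rewrite /f eqxx.
    by move=> i ik; have := h i (ltnW ik); rewrite /f ltn_eqF.
  move=> [h1 h2] i; rewrite ltnS leq_eqVlt /f; case: eqP => [->//|_ /=].
  exact: h1.
have mb : measurable [set w : fam | forall i, (i < k)%N -> B i (w i)].
  have -> : [set w : fam | forall i, (i < k)%N -> B i (w i)] =
      [set w : fam | forall i, i \in iota 0 k -> B i (w i)].
    by apply/seteqP; split => w h i hi; apply: h; move: hi; rewrite mem_iota.
  exact: measurable_box.
rewrite big_ord_recr /= -hP //; exact: product_measure1E.
Qed.

Lemma product_exists (N : nat) : exists P : probability (famB 'I_N R q) R,
  indep_coord P /\ forall k, has_marginal P k mu.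
Proof.
have [P hP] := product_prefix N.
pose f (w : fam) : famB 'I_N R q := fun i => w i.
have mf : measurable_fun setT f.
  by apply: measurable_famP => i; exact: measurable_fam_coord.
have box (s : seq 'I_N) (B : 'I_N -> set (vecB R q)) : uniq s ->
    (forall i, measurable (B i)) ->
    (law P mf [set w | forall i, i \in s -> B i (w i)] = \prod_(i <- s) mu (B i))%E.
  move=> us mB; pose D (i : nat) :=
    if insub i is Some j then (if j \in s then B j else setT) else setT.
  have mD i : measurable (D i) by rewrite /D; case: insubP => // j _ _; case: ifP.
  have DE (i : 'I_N) : D i = if i \in s then B i else setT by rewrite /D valK.
  rewrite lawE (_ : _ @^-1` _ = [set w | forall i, (i < N)%N -> D i (w i)]).
    rewrite hP // [RHS]big_uniq //= [RHS]big_mkcond /=; apply: eq_bigr => i _.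
    by rewrite DE; case: ifP => //; rewrite probability_setT.
  apply/seteqP; split => w /=.
    by move=> h i iN; have := h (Ordinal iN); rewrite (DE (Ordinal iN)); case: ifP => // hi; apply.
  by move=> h i hi; have := h i (ltn_ord i); rewrite DE hi.
have marg i B : measurable B -> law P mf [set w | B (w i)] = mu B.
  move=> mB; have := box [:: i] (fun=> B) isT (fun=> mB).
  rewrite big_seq1 => <-; congr (law P mf _); apply/seteqP; split => w /=.
    by move=> h j; rewrite inE => /eqP->.
  by apply; rewrite inE.
exists (law P mf); split=> // s B us mB; rewrite box //.
by apply: eq_bigr => i _; rewrite marg.
Qed.

End Product.

(** * Centered independent noise on a bounded set *)

Section Noise.
Context {R : realType} {q : nat} (W : set 'cV[R]_q) {I : choiceType}.
Local Notation fam := (famB I R q).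

(** What [ambiguityN] and [iid_class] have in common. *)
Definition noise (P : probability fam R) : Prop :=
  indep_coord P /\ forall i, exists mu, centered_on W mu /\ has_marginal P i mu.

Hypotheses (cW : closed W) (bW : bounded_set W).
Context (P : probability fam R) (nP : noise P).

Lemma bounded_coord n (A : set 'cV[R]_n) : bounded_set A ->
  exists2 C : R, 0 <= C & forall w i, A w -> `|w i 0| <= C.
Proof.
move=> [M [_ hM]]; exists (`|M| + 1); first by rewrite addr_ge0.
move=> w i Aw; have /hM/(_ w Aw) : M < `|M| + 1 by rewrite ltr_pwDr // ler_norm.
apply: le_trans; rewrite /Num.norm /= mx_normrE.
by rewrite (le_trans _ (le_bigmax _ _ (i, 0))).
Qed.

Lemma noise_in i : {ae P, forall w, W (w i)}.
Proof.
have mW : measurable (W : set (vecB R q)) by exact: closed_measurable_vecB.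
have mWi : measurable [set w : fam | W (w i)].
  by rewrite -[X in measurable X]setTI; exact: measurable_fam_coord.
have [_ /(_ i)[mu [[_ muW] mm]]] := nP.
exists (~` [set w : fam | W (w i)]); split => //; first exact: measurableC.
by rewrite probability_setC // mm // muW subee.
Qed.

Lemma asbounded_noise i a : asbounded P (fun w => (w i : 'cV[R]_q) a 0).
Proof.
split.
  apply: (measurableT_comp (measurable_coord a)); exact: measurable_fam_coord.
have [C _ hC] := bounded_coord bW.
by exists C; apply: (ae_mono _ (noise_in i)) => w Ww; exact: hC.
Qed.

Lemma mean_noise i a : mean P (fun w => (w i : 'cV[R]_q) a 0) = 0.
Proof.
have [_ /(_ i)[mu [[mu0 muW] mm]]] := nP.
have mi : measurable_fun setT (fun w : fam => w i : vecB R q).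
  exact: measurable_fam_coord.
pose f (x : vecB R q) : R := (x : 'cV[R]_q) a 0.
have bf : asbounded (law P mi) f.
  apply: (asbounded_lawI mi (measurable_coord a)); exact: asbounded_noise.
rewrite -[LHS](mean_law bf) /mean.
have E A : measurable A -> A `<=` setT -> law P mi A = mu A.
  by move=> mA _; rewrite lawE -mm.
rewrite (eq_measure_integral _ E).
by have := mu0 a; rewrite unlock => ->.
Qed.

Lemma mean_noise_pair i j a b : i != j ->
  mean P (fun w => (w i : 'cV[R]_q) a 0 * (w j : 'cV[R]_q) b 0) = 0.
Proof.
move=> ij; have mi k : measurable_fun setT (fun w : fam => w k : vecB R q).
  exact: measurable_fam_coord.
have H (A B : set (vecB R q)) : measurable A -> measurable B ->
    (P ((fun w : fam => w i : vecB R q) @^-1` A `&` (fun w : fam => w j : vecB R q) @^-1` B) =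
     P ((fun w : fam => w i : vecB R q) @^-1` A) * P ((fun w : fam => w j : vecB R q) @^-1` B))%E.
  move=> mA mB; pose D k := if k == i then A else B.
  have mD k : measurable (D k) by rewrite /D; case: eqP.
  have := nP.1 [:: i; j] D; rewrite /= inE ij => /(_ isT mD).
  rewrite !big_cons big_nil mule1 /D eqxx eq_sym (negPf ij) => <-.
  congr (P _); apply/seteqP; split => w /=.
    by move=> [h1 h2] k; rewrite !inE => /orP[]/eqP->; rewrite ?eqxx // eq_sym (negPf ij).
  move=> h; split; first by have := h i; rewrite eqxx inE eqxx; apply.
  by have := h j; rewrite eq_sym (negPf ij) !inE eqxx orbT; apply.
have := mean_indep (mi i) (mi j) H (measurable_coord a) (measurable_coord b)
  (asbounded_noise i a) (asbounded_noise j b).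
by move=> ->; rewrite [X in X * _](mean_noise i a) mul0r.
Qed.

End Noise.

Lemma noise_past {R : realType} {q : nat} (W : set 'cV[R]_q)
    (P : probability (famB nat R q) R) i a (h : famB nat R q -> R) :
  closed W -> bounded_set W -> noise W P ->
  measurable_fun setT h -> asbounded P (h \o past i) ->
  mean P (fun w => h (past i w) * (w i : 'cV[R]_q) a 0) = 0.
Proof.
move=> cW bW nP mh bh.
have mi : measurable_fun setT (fun w : famB nat R q => w i : vecB R q).
  exact: measurable_fam_coord.
have := mean_indep (measurable_past i) mi (@past_indep _ _ _ nP.1 i) mh
  (measurable_coord a) bh (asbounded_noise cW bW nP i a).
by move=> ->; rewrite [X in _ * X](mean_noise cW bW nP i a) mulr0.
Qed.

Lemma iid_noise {R : realType} {q : nat} (W : set 'cV[R]_q) P :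
  @iid_class R q W P -> noise W P.
Proof. by move=> [iP [P0 [cP0 _ mP]]]; split=> // i; exists P0. Qed.

Lemma ambiguityN_noise {R : realType} {q : nat} (W : set 'cV[R]_q) N d P :
  @ambiguityN R q W N d P -> noise W P.
Proof. by move=> [iP mP]; split=> // i; have [mu [[cmu _] mm]] := mP i; exists mu. Qed.

Lemma ambiguityN_nonempty {R : realType} {q : nat} (W : set 'cV[R]_q) N d :
  admissible W d -> exists P, @ambiguityN R q W N d P.
Proof.
case: d => eps Sh [/= e0 pS hS]; have bS := gelbrich_ball_center e0 pS.
have [mu [cmu smu]] := hS _ bS.
have [P [iP mP]] := product_exists mu N.
exists P; split=> // k; exists mu; split=> //; split=> //.
by exists Sh.
Qed.

(** The constraint on the marginals is the same at each time, and independence is symmetric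
   in the times. *)
Lemma ambiguityN_perm {R : realType} {q : nat} (W : set 'cV[R]_q) N d
    (P : probability (famB 'I_N R q) R) (s t : 'I_N -> 'I_N)
    (mf : measurable_fun setT ((fun w i => w (s i)) : famB 'I_N R q -> famB 'I_N R q)) :
  cancel s t -> ambiguityN W d P -> ambiguityN W d (law P mf).
Proof.
move=> st [iP mP]; split=> [l B ul mB|k]; last first.
  have [mu [amu mm]] := mP (s k).
  by exists mu; split; [exact: amu | move=> B mB; rewrite lawE; exact: mm].
have sinj := can_inj st.
have := iP [seq s i | i <- l] (fun j => B (t j)).
rewrite map_inj_uniq // => /(_ ul (fun i => mB _)).
rewrite big_map; under [in X in _ = X -> _]eq_bigr do rewrite st.
move=> <-; rewrite lawE; congr (P _); apply/seteqP; split => w /= h j.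
  by move=> /mapP[i il ->]; rewrite st; exact: h.
by move=> jl; have := h (s j); rewrite st map_f //; apply.
Qed.

(** * Policies as causal affine maps of the noise *)

Section Affine.
Context {R : realType} {q : nat}.
Implicit Types w : nat -> 'cV[R]_q.

(** The inputs of a policy are such maps; the constructions of policies below compose
   maps and leave the coefficients implicit. *)
Definition aff {p : nat} (k : nat) (f : (nat -> 'cV[R]_q) -> 'cV[R]_p) : Prop :=
  exists (c : 'cV[R]_p) (L : nat -> 'M[R]_(p, q)),
    forall w, f w = c + \sum_(j < k) L j *m w j.

Lemma aff_cst p k (c : 'cV[R]_p) : aff k (fun=> c).
Proof.
by exists c, (fun=> 0) => w; rewrite big1 ?addr0 // => j _; rewrite mul0mx.
Qed.

Lemma aff_ext p k (f g : _ -> 'cV[R]_p) : f =1 g -> aff k f -> aff k g.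
Proof. by move=> fg [c [L E]]; exists c, L => w; rewrite -fg. Qed.

Lemma affD p k (f g : _ -> 'cV[R]_p) : aff k f -> aff k g -> aff k (fun w => f w + g w).
Proof.
move=> [c [L E]] [d [M F]]; exists (c + d), (fun j => L j + M j) => w.
rewrite E F addrACA -big_split /=; congr (_ + _).
by apply: eq_bigr => j _; rewrite mulmxDl.
Qed.

Lemma aff_mul p p' k (A : 'M[R]_(p', p)) (f : _ -> 'cV[R]_p) :
  aff k f -> aff k (fun w => A *m f w).
Proof.
move=> [c [L E]]; exists (A *m c), (fun j => A *m L j) => w.
rewrite E mulmxDr mulmx_sumr; congr (_ + _).
by apply: eq_bigr => j _; rewrite mulmxA.
Qed.

Lemma affN p k (f : _ -> 'cV[R]_p) : aff k f -> aff k (fun w => - f w).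
Proof.
by move=> /(aff_mul (- 1%:M)); apply: aff_ext => w; rewrite mulNmx mul1mx.
Qed.

Lemma aff_widen p k k' (f : _ -> 'cV[R]_p) : (k <= k')%N -> aff k f -> aff k' f.
Proof.
move=> kk' [c [L E]]; exists c, (fun j => if (j < k)%N then L j else 0) => w.
rewrite E; congr (_ + _); rewrite (big_ord_widen k' (fun j => L j *m w j) kk').
rewrite big_mkcond /=; apply: eq_bigr => j _.
by case: ifP => // _; rewrite mul0mx.
Qed.

Lemma aff_noise k p (G : 'M[R]_(p, q)) : aff k.+1 (fun w => G *m w k).
Proof.
exists 0, (fun j => if j == k then G else 0) => w.
rewrite add0r big_ord_recr /= eqxx big1 ?add0r // => j _.
by rewrite ltn_eqF // mul0mx.
Qed.

Definition scons {T : Type} (z : T) (w : nat -> T) (i : nat) : T :=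
  if i is i'.+1 then w i' else z.

Lemma aff_scons p k (f : _ -> 'cV[R]_p) z : aff k.+1 f -> aff k (fun w => f (scons z w)).
Proof.
move=> [c [L E]]; exists (c + L 0%N *m z), (fun j => L j.+1) => w.
by rewrite E big_ord_recl addrA.
Qed.

Lemma aff_head p k (f : _ -> 'cV[R]_p) : aff k f -> exists L : 'M[R]_(p, q),
  forall z w, f (scons z w) = f (scons 0 w) + L *m z.
Proof.
case: k => [|k] [c [L E]].
  by exists 0 => z w; rewrite !E !big_ord0 mul0mx !addr0.
exists (L 0%N) => z w; rewrite !E !big_ord_recl /= mulmx0 add0r.
by rewrite -!addrA; congr (_ + _); rewrite addrC.
Qed.

Lemma aff_eq p k (f : _ -> 'cV[R]_p) w w' : aff k f ->
  (forall i, (i < k)%N -> w i = w' i) -> f w = f w'.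
Proof.
by move=> [c [L E]] ww'; rewrite !E; congr (_ + _); apply: eq_bigr => j _; rewrite ww'.
Qed.

Lemma aff_convex p k (f : _ -> 'cV[R]_p) (s : R) w1 w2 w : aff k f ->
  (forall i, w i = (1 - s) *: w1 i + s *: w2 i) ->
  f w = (1 - s) *: f w1 + s *: f w2.
Proof.
move=> [c [L E]] ws; rewrite !E !scalerDr addrACA -scalerDl subrK scale1r.
congr (_ + _); rewrite !scaler_sumr -big_split; apply: eq_bigr => j _ /=.
by rewrite ws mulmxDr !scalemxAr.
Qed.

End Affine.

Section Policies.
Context {R : realType} {n m q : nat} (S : mpc R n m q).
Local Notation N := (horizon S).
Local Notation vec k := 'cV[R]_k.
Local Notation K := (gainK S).
Implicit Types (th : policy S) (w : nat -> vec q).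

Definition inp th w (i : nat) : vec m := ext0 (input th (fun j : 'I_N => w j)) i.

Definition sta x th w (k : nat) : vec n := state x th (fun j : 'I_N => w j) k.

Lemma ext0_ord k (f : 'I_N -> vec k) (i : 'I_N) : ext0 f i = f i.
Proof. by rewrite /ext0 valK. Qed.

Lemma ext0_nat k (f : nat -> vec k) i : (i < N)%N -> ext0 (fun j : 'I_N => f j) i = f i.
Proof. by move=> iN; rewrite -[(i)]/(val (Ordinal iN)) ext0_ord. Qed.

Lemma inpE th w (i : 'I_N) : inp th w i = input th (fun j : 'I_N => w j) i.
Proof. exact: ext0_ord. Qed.

Lemma restr_ext0 k (w : 'I_N -> vec k) : (fun j : 'I_N => ext0 w j) = w.
Proof. by apply/funext => j; rewrite ext0_ord. Qed.

Lemma sta0 x th w : sta x th w 0 = x.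
Proof. by []. Qed.

Lemma staS x th w k : (k < N)%N ->
  sta x th w k.+1 = sysA S *m sta x th w k + sysB S *m inp th w k + sysG S *m w k.
Proof. by move=> kN; rewrite /sta /state /= ext0_nat. Qed.

Lemma aff_inp th i : aff i (fun w => inp th w i).
Proof.
have [iN|iN] := ltnP i N; last first.
  apply: (aff_ext _ (aff_cst _ 0)) => w.
  by rewrite /inp /ext0; case: insubP => // j; rewrite ltnNge iN.
pose L j := if insub j is Some j' then th.1 (Ordinal iN) j' else 0.
exists (th.2 (Ordinal iN)), L => w.
rewrite -[i in inp _ _ i]/(val (Ordinal iN)) inpE /input; congr (_ + _).
rewrite (big_ord_widen N (fun j => L j *m w j) (ltnW iN)) /=.
by apply: eq_bigr => j _; rewrite /L valK.
Qed.

Lemma aff_sta x th k : (k <= N)%N -> aff k (fun w => sta x th w k).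
Proof.
elim: k => [|k IH] kN; first exact: aff_cst.
apply: (aff_ext (f := fun w => sysA S *m sta x th w k + sysB S *m inp th w k
  + sysG S *m w k)) => [w|]; first by rewrite staS.
apply: affD; last exact: aff_noise.
apply: (aff_widen (leqnSn k)); apply: affD; apply: aff_mul.
  exact/IH/ltnW.
exact: aff_inp.
Qed.

Lemma policy_of_aff (U : nat -> (nat -> vec q) -> vec m) :
  (forall i, aff i (U i)) ->
  exists th, causal th /\ forall w i, (i < N)%N -> inp th w i = U i w.
Proof.
move=> aU; pose c i := projT1 (cid (aU i)); pose L i := projT1 (cid (projT2 (cid (aU i)))).
have UE i w : U i w = c i + \sum_(j < i) L i j *m w j.
  exact: projT2 (cid (projT2 (cid (aU i)))) w.
exists ((fun i j : 'I_N => if (j < i)%N then L i j else 0), fun i : 'I_N => c i); split.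
  by move=> i j /= ij; rewrite ltnNge ij.
move=> w i iN; rewrite -[(i)]/(val (Ordinal iN)) inpE /input UE /=; congr (_ + _).
rewrite (big_ord_widen N (fun j => L i j *m w j) (ltnW iN)) /=.
by apply: eq_bigr => j ->.
Qed.

Lemma feasibleP x th : disW S 0 -> feasible x th <-> causal th /\
  forall w, (forall i, disW S (w i)) ->
    (forall k, (k < N)%N -> conZ S (sta x th w k, inp th w k)) /\
    terX S (sta x th w N).
Proof.
move=> W0; split=> -[cth h]; split=> // w Ww.
  have [hZ hX] := h (fun j : 'I_N => w j) (fun j => Ww j).
  by split=> // k kN; have := hZ (Ordinal kN); rewrite -inpE.
have [i|hZ hX] := h (ext0 w).
  by rewrite /ext0; case: insubP.
rewrite /sta restr_ext0 in hX; split=> // k.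
by have := hZ k (ltn_ord k); rewrite inpE /sta restr_ext0.
Qed.

Lemma big_ord_headE (V : zmodType) (k : nat) (F : nat -> V) : (0 < k)%N ->
  \sum_(i < k) F i = F 0%N + \sum_(i < k.-1) F i.+1.
Proof. by case: k => // k _; rewrite big_ord_recl. Qed.

Lemma big_ord_lastE (V : zmodType) (k : nat) (F : nat -> V) : (0 < k)%N ->
  \sum_(i < k) F i = \sum_(i < k.-1) F i + F k.-1.
Proof. by case: k => // k _; rewrite big_ord_recr. Qed.

Hypothesis N_gt0 : (0 < N)%N.

Definition first_move th : vec m := th.2 (Ordinal N_gt0).

Lemma inp0 th w : inp th w 0 = first_move th.
Proof.
rewrite -[0%N]/(val (Ordinal N_gt0)) inpE /input big1 ?addr0 //.
Qed.

(** [th'] is the remainder of [th] once its first move is played at [x] and the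
   disturbance [z] is observed, completed by one move of the terminal gain. *)
Definition shifted x th z th' : Prop := forall w,
  [/\ forall k, (k < N.-1)%N -> inp th' w k = inp th (scons z w) k.+1,
      inp th' w N.-1 = K *m sta x th (scons z w) N &
      forall k, (k < N)%N ->
        sta (sysA S *m x + sysB S *m first_move th + sysG S *m z) th' w k =
        sta x th (scons z w) k.+1].

Lemma shift_policy x th z : exists th', causal th' /\ shifted x th z th'.
Proof.
pose U k w := if (k < N.-1)%N then inp th (scons z w) k.+1
  else if k == N.-1 then K *m sta x th (scons z w) N else 0.
have aU k : aff k (U k).
  rewrite /U; case: ltnP => kN; first exact: aff_scons (aff_inp _ _).
  case: eqP => [kE|_]; last exact: aff_cst.
  apply: (aff_scons (f := fun w => K *m sta x th w N)); apply: aff_mul.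
  by rewrite kE prednK //; exact: aff_sta.
have [th' [cth' E]] := policy_of_aff aU.
exists th'; split=> // w.
have E1 k : (k < N.-1)%N -> inp th' w k = inp th (scons z w) k.+1.
  by move=> kN; rewrite E /U ?kN // (leq_trans kN) // leq_pred.
split=> //; first by rewrite E /U ?ltnn ?eqxx // ltn_predL.
elim=> [|k IH] kN.
  by rewrite sta0 staS // sta0 inp0.
have kN' : (k < N.-1)%N by rewrite -ltnS prednK.
by rewrite staS 1?ltnW // [RHS]staS // IH 1?ltnW // E1.
Qed.

Lemma shifted_last x th z th' w : shifted x th z th' ->
  sta (sysA S *m x + sysB S *m first_move th + sysG S *m z) th' w N =
  (sysA S + sysB S *m K) *m sta x th (scons z w) N + sysG S *m w N.-1.
Proof.
set xp := _ + _; move=> /(_ w)[_ h2 h3]; have N1 : (N.-1 < N)%N by rewrite ltn_predL.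
rewrite -[in LHS](prednK N_gt0) staS // h2 h3 // prednK //.
by rewrite mulmxA -mulmxDl.
Qed.

Lemma shifted_affine s x th z t0 t1 ts w :
  shifted x th 0 t0 -> shifted x th z t1 -> shifted x th (s *: z) ts ->
  let x' y := sysA S *m x + sysB S *m first_move th + sysG S *m y in
  (forall k, (k <= N)%N ->
    sta (x' (s *: z)) ts w k = (1 - s) *: sta (x' 0) t0 w k + s *: sta (x' z) t1 w k) /\
  (forall k, (k < N)%N -> inp ts w k = (1 - s) *: inp t0 w k + s *: inp t1 w k).
Proof.
move=> h0 h1 hs x'; have [a0 b0 c0] := h0 w; have [a1 b1 c1] := h1 w.
have [as_ bs cs] := hs w.
have sc i : scons (s *: z) w i = (1 - s) *: scons 0 w i + s *: scons z w i.
  by case: i => [|i] /=; rewrite ?scaler0 ?add0r // -scalerDl subrK scale1r.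
have AS k : (k <= N)%N -> sta x th (scons (s *: z) w) k =
    (1 - s) *: sta x th (scons 0 w) k + s *: sta x th (scons z w) k.
  by move=> kN; exact: aff_convex (aff_sta x th kN) sc.
have AI k : inp th (scons (s *: z) w) k =
    (1 - s) *: inp th (scons 0 w) k + s *: inp th (scons z w) k.
  exact: aff_convex (aff_inp th k) sc.
split=> k.
  rewrite leq_eqVlt => /orP[/eqP->|kN]; last by rewrite cs // c0 // c1 // AS.
  rewrite (shifted_last w h0) (shifted_last w h1) (shifted_last w hs) AS //.
  by rewrite mulmxDr -!scalemxAr !scalerDr addrACA -scalerDl subrK scale1r.
move=> kN; have [kN1|kN1] := ltnP k N.-1; first by rewrite as_ // a0 // a1 // AI.
have -> : k = N.-1 by apply/eqP; rewrite eqn_leq kN1 -ltnS prednK // kN.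
by rewrite bs b0 b1 AS // mulmxDr -!scalemxAr.
Qed.

End Policies.

(** * Expected cost of a policy *)

Section VectorBounded.
Context {d} {T : measurableType d} {R : realType} (P : probability T R).

Definition vbounded {n} (f : T -> 'cV[R]_n) : Prop :=
  forall a, asbounded P (fun w => f w a 0).

Lemma vbounded_ext n (f g : T -> 'cV[R]_n) : f =1 g -> vbounded f -> vbounded g.
Proof. by move=> /funext ->. Qed.

Lemma asbounded_ext (f g : T -> R) : f =1 g -> asbounded P f -> asbounded P g.
Proof. by move=> /funext ->. Qed.

Lemma mean_ext (f g : T -> R) : f =1 g -> mean P f = mean P g.
Proof. by move=> /funext ->. Qed.

Lemma vbounded_cst n (c : 'cV[R]_n) : vbounded (fun=> c).
Proof. by move=> a; exact: asbounded_cst. Qed.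

Lemma vboundedD n (f g : T -> 'cV[R]_n) :
  vbounded f -> vbounded g -> vbounded (fun w => f w + g w).
Proof. by move=> bf bg a; under eq_fun do rewrite mxE; exact: asboundedD. Qed.

Lemma vbounded_mul n p (A : 'M[R]_(p, n)) (f : T -> 'cV[R]_n) :
  vbounded f -> vbounded (fun w => A *m f w).
Proof.
move=> bf a; under eq_fun do rewrite mxE.
by apply: asbounded_sum => b _; exact: asboundedZ.
Qed.

Lemma vboundedN n (f : T -> 'cV[R]_n) : vbounded f -> vbounded (fun w => - f w).
Proof.
by move=> /(vbounded_mul (- 1%:M)); under eq_fun do rewrite mulNmx mul1mx.
Qed.

Lemma asbounded_bil n p (M : 'M[R]_(n, p)) (f : T -> 'cV[R]_n) (g : T -> 'cV[R]_p) :
  vbounded f -> vbounded g -> asbounded P (fun w => bil M (f w) (g w)).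
Proof.
move=> bf bg; under eq_fun do rewrite bil_sum.
do 2 (apply: asbounded_sum => ? _); apply: asboundedZ.
exact: asboundedM.
Qed.

Lemma asbounded_quad n (M : 'M[R]_n) (f : T -> 'cV[R]_n) :
  vbounded f -> asbounded P (fun w => quad M (f w)).
Proof. by move=> bf; exact: asbounded_bil. Qed.

Lemma mean_bil n p (M : 'M[R]_(n, p)) (f : T -> 'cV[R]_n) (g : T -> 'cV[R]_p) :
  vbounded f -> vbounded g ->
  mean P (fun w => bil M (f w) (g w)) =
  \sum_i \sum_j M i j * mean P (fun w => f w i 0 * g w j 0).
Proof.
move=> bf bg; under [in LHS]eq_fun do rewrite bil_sum.
have b i j : asbounded P (fun w => M i j * (f w i 0 * g w j 0)).
  by apply: asboundedZ; exact: asboundedM.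
rewrite mean_sum => [|i _]; last by apply: asbounded_sum => j _; exact: b.
apply: eq_bigr => i _; rewrite mean_sum => [|j _]; last exact: b.
by apply: eq_bigr => j _; rewrite meanZ //; exact: asboundedM.
Qed.

End VectorBounded.

Section Cost.
Context {R : realType} {n m q : nat} (S : mpc R n m q).
Local Notation N := (horizon S).
Local Notation vec k := 'cV[R]_k.
Local Notation K := (gainK S).
Local Notation W := (disW S).
Hypotheses (N_gt0 : (0 < N)%N) (cW : closed W) (bW : bounded_set W).
Hypotheses (pQ : psd (wgtQ S)) (pR : pd (wgtR S)) (pP : psd (wgtP S)).
Hypothesis ric : riccati S.

Definition err x (th : policy S) w k : vec m := inp th w k - K *m sta x th w k.

Lemma aff_err x th k : (k <= N)%N -> aff k (fun w => err x th w k).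
Proof.
move=> kN; apply: affD; first exact: aff_inp.
by apply: affN; apply: aff_mul; exact: aff_sta.
Qed.

Lemma cost_nat x th (w : nat -> vec q) :
  cost x th (fun j : 'I_N => w j) =
  \sum_(k < N) stage S (sta x th w k) (inp th w k) + quad (wgtP S) (sta x th w N).
Proof. by congr (_ + _); apply: eq_bigr => k _; rewrite inpE. Qed.

Definition drift x (th : policy S) w k : vec n :=
  sysA S *m sta x th w k + sysB S *m inp th w k.

Lemma cost_square x th (w : nat -> vec q) :
  cost x th (fun j : 'I_N => w j) = quad (wgtP S) x +
  \sum_(k < N) (quad (wgtS S) (err x th w k) +
    2 * bil (wgtP S) (drift x th w k) (sysG S *m w k) + quad (wgtP S) (sysG S *m w k)).
Proof.
rewrite cost_nat (eq_bigr (fun k : 'I_N =>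
   (quad (wgtP S) (sta x th w k) - quad (wgtP S) (sta x th w k.+1)) +
   (quad (wgtS S) (err x th w k) +
    2 * bil (wgtP S) (drift x th w k) (sysG S *m w k) +
    quad (wgtP S) (sysG S *m w k)))); last first.
  move=> k _; rewrite staS // (stage_step pR pP ric _ _ (w k)) /err /drift; ring.
rewrite big_split /= addrAC; congr (_ + _).
rewrite -(big_mkord xpredT (fun k => quad (wgtP S) (sta x th w k) -
  quad (wgtP S) (sta x th w k.+1))).
under eq_bigr do rewrite -opprB.
by rewrite sumrN telescope_sumr // opprB subrK.
Qed.

Section Expectation.
Context (P : probability (famB 'I_N R q) R) (nP : noise W P).

Lemma vbounded_noise (i : 'I_N) : vbounded P (fun w => w i : vec q).
Proof. by move=> a; exact: (asbounded_noise cW bW nP). Qed.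

Lemma vbounded_aff p k (f : (nat -> vec q) -> vec p) : (k <= N)%N -> aff k f ->
  vbounded P (fun w => f (ext0 w)).
Proof.
move=> kN [c [L E]]; apply: (vbounded_ext (f := fun w : famB 'I_N R q => c + \sum_(j < k) L j *m ext0 w j)) => [w|].
  by rewrite E.
apply: vboundedD; first exact: vbounded_cst.
move=> a; apply: (asbounded_ext
  (f := fun w : famB 'I_N R q => \sum_(j < k) (L j *m ext0 w j) a 0)) => [w|].
  by rewrite summxE.
apply: asbounded_sum => j _.
apply: asbounded_ext (vbounded_mul (L j) (vbounded_noise (widen_ord kN j)) a) => w.
by rewrite -ext0_ord.
Qed.

(** The terms of the noise from time [k] on are centered and independent of the earlier
   terms, hence uncorrelated with their affine functions. *)
Lemma mean_cross p k (f : (nat -> vec q) -> vec p) (M : 'M[R]_(p, q)) (i : 'I_N) :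
  aff k f -> (k <= i)%N -> mean P (fun w => bil M (f (ext0 w)) (w i)) = 0.
Proof.
move=> af ki; have kN : (k <= N)%N := leq_trans ki (ltnW (ltn_ord i)).
rewrite (mean_bil M (vbounded_aff kN af) (vbounded_noise i)).
rewrite big1 // => a _; rewrite big1 // => b _.
have [c [L E]] := af; rewrite (_ : mean P _ = 0) ?mulr0 //.
have FE (w : famB 'I_N R q) : f (ext0 w) a 0 * (w i : vec q) b 0 =
    c a 0 * (w i : vec q) b 0 + \sum_(j < k) \sum_(e < q)
      L j a e * ((w (widen_ord kN j) : vec q) e 0 * (w i : vec q) b 0).
  rewrite E mxE mulrDl summxE mulr_suml; congr (_ + _); apply: eq_bigr => j _.
  rewrite mxE mulr_suml; apply: eq_bigr => e _.
  by rewrite mulrA -(ext0_ord w (widen_ord kN j)).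
rewrite (mean_ext P FE).
have bb j e b' : asbounded P (fun w => (w j : vec q) e 0 * (w i : vec q) b' 0).
  by apply: asboundedM; exact: vbounded_noise.
have b1 (j : 'I_k) e : asbounded P (fun w => L j a e * ((w (widen_ord kN j) : vec q) e 0 * (w i : vec q) b 0)).
  by apply: asboundedZ.
rewrite meanD; first last.
- by apply: asbounded_sum => j _; apply: asbounded_sum => e _.
- by apply: asboundedZ; exact: vbounded_noise.
rewrite meanZ ?(mean_noise cW bW nP) ?mulr0 ?add0r; last exact: vbounded_noise.
rewrite mean_sum => [|j _]; last by apply: asbounded_sum.
rewrite big1 // => j _; rewrite mean_sum // big1 // => e _.
rewrite meanZ // (mean_noise_pair cW bW nP) ?mulr0 //.
by apply: contraTneq ki => <-; rewrite -ltnNge /=.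
Qed.

Definition noise_cost : R := \sum_(k < N) mean P (fun w => quad (wgtP S) (sysG S *m w k)).

Definition excess x th : R :=
  \sum_(k < N) mean P (fun w => quad (wgtS S) (err x th (ext0 w) k)).

Lemma ord_leN (k : 'I_N) : (k <= N)%N.
Proof. exact: ltnW. Qed.

Lemma vbounded_err x th (k : 'I_N) : vbounded P (fun w => err x th (ext0 w) k).
Proof. exact: (vbounded_aff (ord_leN k) (aff_err x th (ord_leN k))). Qed.

Lemma aff_drift x th (k : nat) : (k <= N)%N -> aff k (fun w => drift x th w k).
Proof.
move=> kN; apply: affD; apply: aff_mul; [exact: aff_sta | exact: aff_inp].
Qed.

Lemma cost_ext0 x th (w : famB 'I_N R q) : cost x th w = quad (wgtP S) x +
  \sum_(k < N) (quad (wgtS S) (err x th (ext0 w) k) +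
    2 * bil (wgtP S *m sysG S) (drift x th (ext0 w) k) (w k) +
    quad (wgtP S) (sysG S *m w k)).
Proof.
rewrite -[in LHS](restr_ext0 w) cost_square; congr (_ + _).
by apply: eq_bigr => k _; rewrite ext0_ord bil_mulr.
Qed.

Lemma cost_terms_asbounded x th (k : 'I_N) :
  [/\ asbounded P (fun w => quad (wgtS S) (err x th (ext0 w) k)),
      asbounded P (fun w => 2 * bil (wgtP S *m sysG S) (drift x th (ext0 w) k) (w k)) &
      asbounded P (fun w => quad (wgtP S) (sysG S *m w k))].
Proof.
split.
- exact/asbounded_quad/vbounded_err.
- apply: asboundedZ; apply: asbounded_bil; last exact: vbounded_noise.
  exact: (vbounded_aff (ord_leN k) (aff_drift x th (ord_leN k))).
- exact/asbounded_quad/vbounded_mul/vbounded_noise.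
Qed.

Lemma asbounded_cost x th : asbounded P (cost x th).
Proof.
apply: (asbounded_ext (fun w => esym (cost_ext0 x th w))).
apply: asboundedD; first exact: asbounded_cst.
apply: asbounded_sum => k _; have [b1 b2 b3] := cost_terms_asbounded x th k.
by apply: asboundedD => //; apply: asboundedD.
Qed.

(** The expected cost separates into the cost-to-go of the state, the penalty for
   departing from the gain, and the cost of the noise, which no policy affects. *)
Lemma mean_cost x th :
  mean P (cost x th) = quad (wgtP S) x + excess x th + noise_cost.
Proof.
rewrite (mean_ext P (cost_ext0 x th)).
rewrite meanD; [|exact: asbounded_cst|]; last first.
  apply: asbounded_sum => k _; have [b1 b2 b3] := cost_terms_asbounded x th k.
  by apply: asboundedD => //; apply: asboundedD.
rewrite mean_cst -addrA; congr (_ + _); rewrite mean_sum => [|k _]; last first.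
  have [b1 b2 b3] := cost_terms_asbounded x th k.
  by apply: asboundedD => //; apply: asboundedD.
rewrite -big_split /=; apply: eq_bigr => k _.
have [b1 b2 b3] := cost_terms_asbounded x th k.
rewrite meanD //; last exact: asboundedD.
rewrite meanD // meanZ; last first.
  apply: asbounded_bil; last exact: vbounded_noise.
  exact: (vbounded_aff (ord_leN k) (aff_drift x th (ord_leN k))).
by rewrite (mean_cross _ (aff_drift x th (ord_leN k))) // mulr0 addr0.
Qed.

Lemma excess_ge x th :
  quad (wgtS S) (first_move N_gt0 th - K *m x) <= excess x th.
Proof.
rewrite /excess (bigD1 (Ordinal N_gt0)) //= -[leLHS]addr0 lerD //.
  rewrite -[leLHS](mean_cst P) le_eqVlt; apply/orP; left; apply/eqP/mean_ext => w.
  by rewrite /err inp0.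
apply: sumr_ge0 => k _; apply: mean_ge; first exact/asbounded_quad/vbounded_err.
by apply: aeW => w; exact: wgtS_ge0.
Qed.

End Expectation.

Section Shift.
Context (P : probability (famB 'I_N R q) R) (nP : noise W P).

(** The shifted policy meets its noise one step later than [th] does. Under the cyclic
   permutation the later terms of the noise of [th] are the earlier terms of that of the
   shifted policy, and the first one is its last, on which no input of the shifted
   policy depends. *)
Definition cycle_noise (w : 'I_N -> vec q) (i : 'I_N) : vec q := w (ord_pred i).

Lemma measurable_cycle_noise :
  measurable_fun setT (cycle_noise : famB 'I_N R q -> famB 'I_N R q).
Proof. by apply: measurable_famP => i; exact: measurable_fam_coord. Qed.

Local Notation cP := (law P measurable_cycle_noise).

Lemma ambiguityN_cycle d : ambiguityN W d P -> ambiguityN W d cP.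
Proof. exact: (ambiguityN_perm _ (@ord_predK N)). Qed.

Definition last_ord : 'I_N := ord_pred (Ordinal N_gt0).

Lemma cycle_noiseE (w : 'I_N -> vec q) k : (k < N)%N ->
  ext0 (cycle_noise w) k = scons (w last_ord) (ext0 w) k.
Proof.
move=> kN; rewrite -[(k)]/(val (Ordinal kN)) ext0_ord /cycle_noise.
case: k kN => [|k] kN /=; first by congr w; exact: val_inj.
rewrite -[(k)]/(val (Ordinal (ltnW kN))) ext0_ord; congr w; apply: val_inj => /=.
by rewrite modnDr modn_small // ltnW.
Qed.

Lemma noise_cost_cycle : noise W cP -> noise_cost cP = noise_cost P.
Proof.
move=> ncP; rewrite /noise_cost [RHS](reindex_inj (can_inj (@ord_predK N))) /=.
apply: eq_bigr => k _; rewrite mean_law //.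
by apply/asbounded_quad/vbounded_mul/vbounded_noise.
Qed.

(** Restoring the disturbance [0] in place of the first one can only decrease the expected
   penalties, by Jensen's inequality. *)
Lemma excess_cycle x th : noise W cP ->
  quad (wgtS S) (first_move N_gt0 th - K *m x) +
  \sum_(k < N.-1) mean P (fun w => quad (wgtS S) (err x th (scons 0 (ext0 w)) k.+1))
  <= excess cP x th.
Proof.
move=> ncP; pose F k := mean P (fun w =>
  quad (wgtS S) (err x th (scons ((w : 'I_N -> vec q) last_ord) (ext0 w)) k)).
have -> : excess cP x th = \sum_(k < N) F k.
  apply: eq_bigr => k _; rewrite mean_law; last exact/asbounded_quad/vbounded_err.
  apply: mean_ext => w /=; congr quad; apply: (aff_eq (aff_err x th (ord_leN k))).
  by move=> i ik; apply: cycle_noiseE; exact: ltn_trans (ltn_ord k).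
rewrite big_ord_headE // lerD //.
  rewrite -[leLHS](mean_cst P) le_eqVlt; apply/orP; left; apply/eqP/mean_ext => w.
  by rewrite /err inp0.
apply: ler_sum => k _; have kN : (k.+1 < N)%N by rewrite -ltn_predRL.
have [L hL] := aff_head (aff_err x th (ltnW kN)).
have aE := aff_scons 0 (aff_err x th (ltnW kN)).
have kN' : (k <= N)%N by rewrite ltnW // ltnW.
have bE := vbounded_aff nP kN' aE.
have bz := vbounded_noise nP last_ord; have bLz := vbounded_mul L bz.
have sS := (wgtS_pd pR pP).1.
rewrite /F [leRHS](mean_ext P (g := fun w => quad (wgtS S) (err x th (scons 0 (ext0 w)) k.+1)
   + 2 * bil (wgtS S *m L) (err x th (scons 0 (ext0 w)) k.+1) (w last_ord)
   + quad (wgtS S) (L *m w last_ord))); last first.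
  by move=> w /=; rewrite hL quadD ?bil_mulr.
have b1 := asbounded_quad (wgtS S) bE.
have b2 := asbounded_bil (wgtS S *m L) bE bz.
have b3 := asbounded_quad (wgtS S) bLz.
rewrite meanD //; last by apply: asboundedD => //; exact: asboundedZ.
rewrite meanD //; last exact: asboundedZ.
rewrite meanZ // (mean_cross nP _ aE); last first.
  by rewrite /= modn_small ?ltn_predL // ltnW.
rewrite mulr0 addr0 lerDl; apply: mean_ge => //.
by apply: aeW => w; exact: wgtS_ge0.
Qed.

(** Undisturbed, the shifted policy costs less than [th] by the stage cost of the
   first move: [th] also pays for its reaction to a first disturbance, which the
   shifted policy, ending with the optimal gain, only pays at its optimal price. *)
Lemma shift_cost x th th' : noise W cP -> 
  shifted N_gt0 x th 0 th' ->
  mean P (cost (sysA S *m x + sysB S *m first_move N_gt0 th + sysG S *m 0) th') <=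
  mean cP (cost x th) - stage S x (first_move N_gt0 th).
Proof.
move=> ncP h; set u := first_move N_gt0 th in h *; set xp := (X in cost X th').
rewrite !mean_cost // noise_cost_cycle //.
have -> : excess P xp th' =
    \sum_(k < N.-1) mean P (fun w => quad (wgtS S) (err x th (scons 0 (ext0 w)) k.+1)).
  pose F k := mean P (fun w => quad (wgtS S) (err xp th' (ext0 w) k)).
  rewrite [LHS](big_ord_lastE F N_gt0) [X in _ + X](_ : _ = 0) ?addr0.
    apply: eq_bigr => k _; apply: mean_ext => w; have [h1 _ h3] := h (ext0 w).
    rewrite /err h1 // h3 //; exact: leq_trans (leq_pred _).
  rewrite /F -[RHS](mean_cst P); apply: mean_ext => w; have [_ h2 h3] := h (ext0 w).
  by rewrite /err h2 h3 ?ltn_predL // prednK // subrr quad0.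
have := excess_cycle x th ncP; rewrite -/u.
have := stage_riccati pR pP ric x u.
rewrite /xp mulmx0 addr0; lra.
Qed.

Lemma cost_ge0 x th (w : 'I_N -> vec q) : 0 <= cost x th w.
Proof.
by rewrite addr_ge0 ?pP.2 // sumr_ge0 // => k _; apply: stage_ge0.
Qed.

Lemma stage_convex s x y u v : 0 <= s <= 1 ->
  stage S ((1 - s) *: x + s *: y) ((1 - s) *: u + s *: v) <=
  (1 - s) * stage S x u + s * stage S y v.
Proof.
move=> s01; rewrite /stage !mulrDr addrACA lerD //; apply: quad_convex => //.
exact: pd_psd.
Qed.

Lemma cost_convex s x0 x1 x2 th0 th1 th2 w : 0 <= s <= 1 ->
  (forall k, (k <= N)%N -> sta x2 th2 w k = (1 - s) *: sta x0 th0 w k + s *: sta x1 th1 w k) ->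
  (forall k, (k < N)%N -> inp th2 w k = (1 - s) *: inp th0 w k + s *: inp th1 w k) ->
  cost x2 th2 (fun j : 'I_N => w j) <=
  (1 - s) * cost x0 th0 (fun j : 'I_N => w j) + s * cost x1 th1 (fun j : 'I_N => w j).
Proof.
move=> s01 hs hi; rewrite !cost_nat !mulrDr addrACA lerD //; last first.
  by rewrite hs //; exact: quad_convex.
rewrite !mulr_sumr -big_split; apply: ler_sum => k _ /=.
by rewrite hs ?hi //; [exact: stage_convex | exact: ltnW].
Qed.

End Shift.
End Cost.

(** * The controller *)

Section Bounds.
Context {R : realType}.

Definition ebound {n} (b : R) (x : 'cV[R]_n) : Prop := forall i, `|x i 0| <= b.

Lemma ebound_mul n p (A : 'M[R]_(p, n)) (b : R) :
  exists C, forall x, ebound b x -> ebound C (A *m x).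
Proof.
exists (\sum_i \sum_j `|A i j| * b) => x hx i.
have b0 j : 0 <= `|A i j| * b by rewrite mulr_ge0 // (le_trans _ (hx j)).
rewrite mxE (le_trans (ler_norm_sum _ _ _)) //.
apply: (@le_trans _ _ (\sum_j `|A i j| * b)).
  by apply: ler_sum => j _; rewrite normrM ler_wpM2l.
rewrite [leRHS](bigD1 i) //= lerDl; apply: sumr_ge0 => k _.
by apply: sumr_ge0 => j _; rewrite mulr_ge0 // (le_trans _ (hx j)).
Qed.

Lemma eboundD n (b c : R) (x y : 'cV[R]_n) :
  ebound b x -> ebound c y -> ebound (b + c) (x + y).
Proof. by move=> hx hy i; rewrite mxE (le_trans (ler_normD _ _)) // lerD. Qed.

Lemma eboundW n (b c : R) (x : 'cV[R]_n) : b <= c -> ebound b x -> ebound c x.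
Proof. by move=> bc hx i; rewrite (le_trans (hx i)). Qed.

Lemma quad_ebound n (M : 'M[R]_n) (b : R) :
  exists2 C : R, 0 <= C & forall x, ebound b x -> quad M x <= C.
Proof.
have [c c0 hc] := quad_le M; exists (c * b ^+ 2); first by rewrite mulr_ge0 ?sqr_ge0.
move=> x hx; apply: hc => i; rewrite -[leLHS]real_normK ?num_real //.
by rewrite lerXn2r // nnegrE // (le_trans _ (hx i)).
Qed.

Lemma bounded_ebound n (A : set 'cV[R]_n) : bounded_set A ->
  exists2 C : R, 0 <= C & forall x, A x -> ebound C x.
Proof. by move=> /bounded_coord[C C0 h]; exists C => // x Ax i; exact: h. Qed.

Lemma interior0_ebound n (A : set 'cV[R]_n) : A° 0 ->
  exists2 r : R, 0 < r & forall x, ebound r x -> A x.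
Proof.
move=> /nbhs_ballP[e /= e0 h]; exists (e / 2); first by rewrite divr_gt0.
move=> x hx; apply: h; split=> // i j; rewrite ord1 /ball /= mxE sub0r normrN.
by rewrite (le_lt_trans (hx i)) // ltr_pdivrMr // ltr_pMr // ltr1n.
Qed.

End Bounds.

Section Controller.
Context {R : realType} {n m q : nat} (S : mpc R n m q).
Local Notation N := (horizon S).
Local Notation vec k := 'cV[R]_k.
Local Notation K := (gainK S).
Local Notation W := (disW S).
Local Notation X := (feasible_set S).
Hypothesis N_gt0 : (0 < N)%N.
Hypothesis Z_sub : conZ S `<=` [set z | inU S z.2].
Hypotheses (cW : closed W) (bW : bounded_set W) (bU : bounded_set (inU S)).
Hypothesis W0 : W 0.
Hypothesis W_int : W° 0.
Hypotheses (Q_pd : pd (wgtQ S)) (pR : pd (wgtR S)) (pP : psd (wgtP S)).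
Hypothesis ric : riccati S.
Hypothesis Xf_inv : forall x w, terX S x -> W w ->
  conZ S (x, K *m x) /\ terX S ((sysA S + sysB S *m K) *m x + sysG S *m w).
Hypothesis Xf_int : (terX S)° 0.

Let pQ : psd (wgtQ S) := pd_psd Q_pd.

(** The inputs are bounded because [inU S] is, and so are the states, over a
   finite horizon; the bounds do not depend on the policy. *)
Lemma traj_bound (b : R) : exists Cx Cu : R, forall x, ebound b x ->
  forall th : policy S, feasible x th -> forall w, (forall i, W (w i)) ->
  (forall k, (k <= N)%N -> ebound Cx (sta x th w k)) /\
  (forall k, (k < N)%N -> ebound Cu (inp th w k)).
Proof.
have [Cu Cu0 hu] := bounded_ebound bU; have [Cw Cw0 hw] := bounded_ebound bW.
have hinp x (th : policy S) w : feasible x th -> (forall i, W (w i)) ->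
    forall k, (k < N)%N -> ebound Cu (inp th w k).
  move=> /(feasibleP _ _ W0)[_ h] Ww k kN; have [hZ _] := h w Ww.
  by apply: hu; exact: Z_sub (hZ k kN).
suff [Cx hx] : exists Cx : R, forall x, ebound b x -> forall th : policy S, feasible x th ->
    forall w, (forall i, W (w i)) ->
    forall k, (k <= N)%N -> ebound Cx (sta x th w k).
  by exists Cx, Cu => x bx th fx w Ww; split; [exact: hx | exact: hinp fx Ww].
suff H j : exists Cx : R, forall x, ebound b x -> forall th : policy S, feasible x th ->
    forall w, (forall i, W (w i)) ->
    forall k, (k <= j)%N -> (k <= N)%N -> ebound Cx (sta x th w k).
  by have [Cx hx] := H N; exists Cx => x bx th fx w Ww k kN; exact: hx.
elim: j => [|j [Cx hx]].
  by exists b => x bx th fx w Ww k; rewrite leqn0 => /eqP->.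
have [CA hA] := ebound_mul (sysA S) Cx; have [CB hB] := ebound_mul (sysB S) Cu.
have [CG hG] := ebound_mul (sysG S) Cw.
exists (Num.max Cx (CA + CB + CG)) => x bx th fx w Ww k.
rewrite leq_eqVlt ltnS => /orP[/eqP->|kj] kN; last first.
  by apply: (@eboundW _ _ Cx); [rewrite le_max lexx | exact: hx].
rewrite staS //; apply: (@eboundW _ _ (CA + CB + CG)).
  by rewrite le_max lexx orbT.
apply: eboundD; last exact/hG/hw/Ww.
apply: eboundD; first by apply/hA/hx => //; exact: ltnW.
by apply: hB; exact: hinp fx Ww _ _.
Qed.

Lemma cost_bound (b : R) : exists2 C : R, 0 <= C & forall x, ebound b x ->
  forall th : policy S, feasible x th -> forall w : 'I_N -> vec q, (forall i, W (w i)) ->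
  cost x th w <= C.
Proof.
have [Cx [Cu h]] := traj_bound b.
have [c1 c10 h1] := quad_ebound (wgtQ S) Cx.
have [c2 c20 h2] := quad_ebound (wgtR S) Cu.
have [c3 c30 h3] := quad_ebound (wgtP S) Cx.
exists (\sum_(k < N) (c1 + c2) + c3).
  by rewrite addr_ge0 // sumr_ge0 // => k _; rewrite addr_ge0.
move=> x bx th fx w Ww; have We i : W (ext0 w i) by rewrite /ext0; case: insubP.
have [hs hi] := h x bx th fx _ We.
rewrite -[w](restr_ext0 (S := S)) cost_nat; apply: lerD; last exact/h3/hs.
by apply: ler_sum => k _; apply: lerD; [exact/h1/hs/ltnW | exact/h2/hi].
Qed.

Lemma noise_all (P : probability (famB 'I_N R q) R) : noise W P ->
  {ae P, forall w, forall i, W (w i)}.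
Proof. by move=> nP; apply: ae_forall_ord => i; exact: noise_in cW P nP i. Qed.

Section Fixed.
Context (d : R * 'M[R]_q) (ad : admissible W d).

Lemma worst_cost_ge x (th : policy S) P : ambiguityN W d P ->
  ((mean P (cost x th))%:E <= worst_cost d x th)%E.
Proof.
move=> aP; rewrite -expectation_mean; last first.
  exact: (asbounded_cost cW bW pR pP ric (ambiguityN_noise aP)).
by apply: ereal_sup_ubound; exists P.
Qed.

Lemma worst_cost_le x (th : policy S) C :
  (forall P, ambiguityN W d P -> mean P (cost x th) <= C) ->
  (worst_cost d x th <= C%:E)%E.
Proof.
move=> h; apply: ge_ereal_sup => _ [P aP <-].
rewrite expectation_mean ?lee_fin; first exact: h.
exact: (asbounded_cost cW bW pR pP ric (ambiguityN_noise aP)).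
Qed.

Lemma mean_cost_bound b : exists2 C : R, 0 <= C & forall x, ebound b x ->
  forall th : policy S, feasible x th -> forall P : probability (famB 'I_N R q) R, noise W P ->
  mean P (cost x th) <= C.
Proof.
have [C C0 h] := cost_bound b; exists C => // x bx th fx P nP.
apply: mean_bound; first exact: (asbounded_cost cW bW pR pP ric nP).
by apply: ae_mono (noise_all nP) => w Ww; exact: h.
Qed.

Lemma ebound_exists k (x : vec k) : exists b : R, ebound b x.
Proof.
exists (\sum_i `|x i 0|) => i; rewrite (bigD1 i) //= lerDl.
by apply: sumr_ge0.
Qed.

(** The nonempty ambiguity set bounds the supremum from below. *)
Lemma worst_cost_fin x (th : policy S) : feasible x th ->
  worst_cost d x th \is a fin_num.
Proof.
move=> fx; have [b bx] := ebound_exists x; have [C C0 h] := mean_cost_bound b.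
have [P aP] := ambiguityN_nonempty N ad.
apply/fin_numP; split; apply/eqP => E.
  by have := worst_cost_ge x th aP; rewrite E.
suff : (worst_cost d x th <= C%:E)%E by rewrite E.
by apply: worst_cost_le => P' aP'; apply: (h x) => //; exact: ambiguityN_noise aP'.
Qed.

Definition value (x : vec n) : R :=
  fine (ereal_inf [set worst_cost d x th | th in @feasible R n m q S x]).

Lemma optimal_value x (th : policy S) : optimal d x th ->
  worst_cost d x th = (value x)%:E.
Proof.
move=> [fx ox]; have E : ereal_inf [set worst_cost d x th | th in @feasible R n m q S x]
    = worst_cost d x th.
  apply/eqP; rewrite eq_le; apply/andP; split.
    by apply: ereal_inf_lbound; exists th.
  by apply: le_ereal_inf_tmp => _ [th' fx' <-]; exact: ox.
by rewrite /value E fineK // worst_cost_fin.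
Qed.

Context (kappa : vec n -> vec m) (lawk : control_law S d kappa).

Lemma control_optimal x : X x -> exists2 th : policy S, optimal d x th &
  first_move N_gt0 th = kappa x.
Proof.
move=> Xx; have [_ _ /(_ x Xx)[th oth h]] := lawk.
by exists th => //; rewrite (h (Ordinal N_gt0)).
Qed.

Lemma value_le x (th : policy S) C : X x -> feasible x th ->
  (forall P, ambiguityN W d P -> mean P (cost x th) <= C) -> value x <= C.
Proof.
move=> Xx fx h; have [th0 oth0 _] := control_optimal Xx.
rewrite -lee_fin -(optimal_value oth0) (le_trans (oth0.2 _ fx)) //.
exact: worst_cost_le.
Qed.

Lemma value_ge0 x : X x -> 0 <= value x.
Proof.
move=> Xx; have [th oth _] := control_optimal Xx.
have [P aP] := ambiguityN_nonempty N ad.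
rewrite -lee_fin -(optimal_value oth); apply: le_trans (worst_cost_ge x th aP).
rewrite lee_fin; apply: mean_ge.
  exact: (asbounded_cost cW bW pR pP ric (ambiguityN_noise aP)).
by apply: aeW => w; exact: (cost_ge0 pQ pR pP).
Qed.

(** The terminal set is invariant under the gain, and the states that the gain produces
   are affine in the noise. *)
Lemma gain_policy x : terX S x -> exists th : policy S, feasible x th /\
  forall w k, (k < N)%N -> err x th w k = 0.
Proof.
move=> Xfx; pose z w k := closed_loop S (fun y => K *m y) x w k.
have az k : aff k (fun w => z w k).
  elim: k => [|k IH]; first exact: aff_cst.
  apply: affD; last exact: aff_noise.
  by apply: (aff_widen (leqnSn k)); apply: affD; do ?apply: aff_mul; exact: IH.
have [th [cth E]] := policy_of_aff S (fun k => aff_mul K (az k)).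
have zs w k : (k <= N)%N -> sta x th w k = z w k.
  by elim: k => [//|k IH] kN; rewrite staS // IH ?E // ltnW.
have zX w k : (forall i, W (w i)) -> terX S (z w k).
  move=> Ww; elim: k => [//|k IH]; rewrite /z /= -/(z w k).
  by have [_] := Xf_inv IH (Ww k); rewrite mulmxDl -mulmxA.
exists th; split; last by move=> w k kN; rewrite /err E // zs ?subrr // ltnW.
apply/feasibleP => //; split=> // w Ww; split=> [k kN|]; last by rewrite zs; [exact: zX|].
rewrite E // zs; last exact: ltnW.
by have [] := Xf_inv (zX w k Ww) (Ww k).
Qed.

Lemma terminal_feasible x : terX S x -> X x.
Proof. by move=> /gain_policy[th [fx _]]; exists th. Qed.

(** On the terminal set the gain is the only optimal first move: any other costs
   more under every distribution, by at least the penalty for that move. *)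
Lemma terminal_control x : terX S x -> kappa x = K *m x.
Proof.
move=> Xfx; have Xx := terminal_feasible Xfx.
have [th oth <-] := control_optimal Xx; have [thK [fK eK]] := gain_policy Xfx.
set u := first_move N_gt0 th.
have wf := worst_cost_fin oth.1; have wK := worst_cost_fin fK.
have le1 : (worst_cost d x thK <= (value x - quad (wgtS S) (u - K *m x))%:E)%E.
  apply: worst_cost_le => P aP; have nP := ambiguityN_noise aP.
  rewrite lerBrDr -lee_fin -(optimal_value oth).
  apply: le_trans (worst_cost_ge x th aP); rewrite lee_fin.
  rewrite !(mean_cost cW bW pR pP ric nP).
  have -> : excess P x thK = 0.
    apply: big1 => k _; rewrite -[RHS](mean_cst P); apply: mean_ext => w.
    by rewrite eK // quad0.
  have := excess_ge N_gt0 cW bW pR pP nP x th; rewrite -/u; lra.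
have := le_trans (oth.2 _ fK) le1; rewrite (optimal_value oth) lee_fin => le2.
have q0 : quad (wgtS S) (u - K *m x) <= 0 by lra.
have pS := wgtS_pd pR pP.
apply/eqP; rewrite -subr_eq0; apply: contraT => /(pS.2 _); lra.
Qed.

Lemma shift_feasible x (th th' : policy S) z : feasible x th -> W z -> causal th' ->
  shifted N_gt0 x th z th' ->
  feasible (sysA S *m x + sysB S *m first_move N_gt0 th + sysG S *m z) th'.
Proof.
set xp := _ + _; move=> /(feasibleP _ _ W0)[_ fx] Wz cth' h.
apply/(feasibleP _ _ W0); split=> // w Ww; have [h1 h2 h3] := h w.
have Wzw i : W (scons z w i) by case: i.
have [hZ hX] := fx _ Wzw.
have N1 : (N.-1 < N)%N by rewrite ltn_predL.
have [hZK hXK] := Xf_inv hX (Ww N.-1).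
split=> [k kN|].
  have [kN1|] := ltnP k N.-1.
    by rewrite h1 // h3 //; apply: hZ; rewrite -ltn_predRL.
  move=> kN1; have -> : k = N.-1 by apply/eqP; rewrite eqn_leq kN1 -ltnS prednK // kN.
  by rewrite h2 h3 // prednK.
by rewrite (shifted_last w h).
Qed.

Lemma control_invariant x z : X x -> W z ->
  X (sysA S *m x + sysB S *m kappa x + sysG S *m z).
Proof.
move=> Xx Wz; have [th oth <-] := control_optimal Xx.
have [th' [cth' h]] := shift_policy N_gt0 x th z.
by exists th'; exact: shift_feasible oth.1 Wz cth' h.
Qed.

Lemma cost_bound_mean b C (th : policy S) x (P : probability (famB 'I_N R q) R) :
  (forall x, ebound b x -> forall th : policy S, feasible x th ->
    forall P : probability (famB 'I_N R q) R, noise W P -> mean P (cost x th) <= C) ->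
  (forall x, X x -> ebound b x) -> feasible x th -> noise W P ->
  mean P (cost x th) <= C.
Proof. by move=> h Xb fx nP; apply: h => //; apply: Xb; exists th. Qed.

(** Along the closed loop the value decreases by the stage cost, up to an error
   proportional to the disturbance. Without disturbance this is the comparison
   with the shifted policy. The cost of the shifted policies is convex in the
   disturbance, so that the error at [s z] is at most [s] times that at [z]. *)
Lemma descent b : (forall x, X x -> ebound b x) ->
  exists2 C : R, 0 <= C & (forall x, X x -> value x <= C) /\
  forall x s z, X x -> 0 <= s <= 1 -> W z -> W (s *: z) ->
    value (sysA S *m x + sysB S *m kappa x + sysG S *m (s *: z)) <=
    value x - stage S x (kappa x) + s * C.
Proof.
move=> Xb; have [C C0 hC] := mean_cost_bound b; exists C => //; split.
  move=> x Xx; have [th oth _] := control_optimal Xx.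
  apply: (value_le Xx oth.1) => P aP.
  exact: (cost_bound_mean hC Xb oth.1 (ambiguityN_noise aP)).
move=> x s z Xx s01 Wz Wsz; have [th oth <-] := control_optimal Xx.
have [t0 [c0 h0]] := shift_policy N_gt0 x th 0.
have [t1 [c1 h1]] := shift_policy N_gt0 x th z.
have [ts [cs hs]] := shift_policy N_gt0 x th (s *: z).
have f0 := shift_feasible oth.1 W0 c0 h0.
have f1 := shift_feasible oth.1 Wz c1 h1.
have fs := shift_feasible oth.1 Wsz cs hs.
apply: (value_le _ fs) => [|P aP]; first by exists ts.
have nP := ambiguityN_noise aP.
have acP := ambiguityN_cycle aP; have ncP := ambiguityN_noise acP.
have m0 := shift_cost cW bW pR pP ric nP ncP h0.
have m0' : mean P (cost (sysA S *m x + sysB S *m first_move N_gt0 th + sysG S *m 0) t0)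
    <= value x - stage S x (first_move N_gt0 th).
  apply: (le_trans m0); rewrite lerD2r -lee_fin -(optimal_value oth).
  exact: worst_cost_ge.
have m1 := cost_bound_mean hC Xb f1 nP.
have bc y t : asbounded P (cost y t) := asbounded_cost cW bW pR pP ric nP y t.
have c0' : 0 <= mean P (cost (sysA S *m x + sysB S *m first_move N_gt0 th + sysG S *m 0) t0).
  by apply: mean_ge => //; apply: aeW => w; exact: (cost_ge0 pQ pR pP).
set c0_ := mean P _ in m0' c0'; set c1_ := mean P _ in m1.
apply: (@le_trans _ _ ((1 - s) * c0_ + s * c1_)).
  rewrite -!meanZ // -meanD; [|exact: asboundedZ..].
  apply: mean_le => //; first by apply: asboundedD; exact: asboundedZ.
  apply: aeW => w; rewrite -[w](restr_ext0 (S := S)).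
  have [a1 a2] := shifted_affine (ext0 w) h0 h1 hs.
  exact: (cost_convex pQ pR pP).
by move/andP: s01 => [s0 s1]; nra.
Qed.

Local Notation loop := (closed_loop S kappa).

Lemma loop_feasible x w k : X x -> (forall i, W (w i)) -> X (loop x w k).
Proof. by move=> Xx Ww; elim: k => [//|k IH] /=; exact: control_invariant. Qed.

Lemma terminal_step x z : terX S x -> W z ->
  terX S (sysA S *m x + sysB S *m kappa x + sysG S *m z).
Proof.
move=> Xfx Wz; have [_] := Xf_inv Xfx Wz.
by rewrite terminal_control // mulmxDl -mulmxA.
Qed.

Lemma enorm_ebound k (z : vec k) (e : R) : enorm z <= e -> ebound e z.
Proof.
move=> ze i; apply: le_trans ze; rewrite -sqrtr_sqr; apply: ler_wsqrtr.
by rewrite (bigD1 i) //= lerDl sumr_ge0 // => j _; exact: sqr_ge0.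
Qed.

(** Outside the terminal set the stage cost is bounded below, since [Q] is definite and
   the terminal set is a neighbourhood of the origin. While the disturbances are small,
   the value then decreases at a fixed rate, and it is nonnegative: the terminal set is
   reached within a fixed time. *)
Lemma hitting b : (forall x, X x -> ebound b x) ->
  exists (eps : R) (T : nat), 0 < eps /\
  forall x w, X x -> (forall i, (i < T)%N -> enorm (w i) <= eps) ->
    terX S (loop x w T).
Proof.
move=> Xb; have [C C0 [VC dec]] := descent Xb.
have [r r0 Wr] := interior0_ebound W_int; have [rho rho0 Xr] := interior0_ebound Xf_int.
have [c c0 hc] := pd_coord_le Q_pd.
pose eta := rho ^+ 2 / (c + 1).
have c1 : 0 < c + 1 by rewrite ltr_wpDl.
have eta0 : 0 < eta by rewrite divr_gt0 // exprn_gt0.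
have etaQ x u : ~ terX S x -> eta <= stage S x u.
  move=> nX; have [i hi] : exists i, rho < `|x i 0|.
    apply: contrapT => h; apply: nX; apply: Xr => i; rewrite leNgt; apply/negP => hi.
    by apply: h; exists i.
  apply: (@le_trans _ _ (quad (wgtQ S) x)); last by rewrite lerDl (pd_psd pR).2.
  rewrite ler_pdivrMr // mulrC; apply: (@le_trans _ _ (x i 0 ^+ 2)).
    by rewrite -[leRHS]real_normK ?num_real // lerXn2r ?nnegrE ?(ltW rho0) ?(ltW hi).
  by apply: (le_trans (hc x i)); rewrite ler_wpM2r ?pQ.2 // lerDl.
(* The error [s * C] that disturbances of size [s * r] cause is at most half of [eta]. *)
pose s := Num.min 1 (eta / (2 * (C + 1))).
have C1 : 0 < 2 * (C + 1) by rewrite mulr_gt0 // ltr_wpDl.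
have s0 : 0 < s by rewrite lt_min ltr01 divr_gt0.
have s1 : s <= 1 by rewrite ge_min lexx.
have sC : s * C <= eta / 2.
  have : s <= eta / (2 * (C + 1)) by rewrite ge_min lexx orbT.
  rewrite ler_pdivlMr // => h; rewrite ler_pdivlMr //; nra.
have [T hT] : exists T : nat, C < T%:R * (eta / 2).
  have e2 : 0 < eta / 2 by rewrite divr_gt0.
  exists (Num.bound (C / (eta / 2))); rewrite -ltr_pdivrMr //.
  by apply: archi_boundP; rewrite divr_ge0 // ltW.
exists (s * r), T; split; first by rewrite mulr_gt0.
move=> x w Xx hw.
have small i : (i < T)%N -> W (s^-1 *: w i) /\ W (w i).
  move=> iT; have /enorm_ebound h := hw i iT; split; apply: Wr => j; last first.
    by apply: (le_trans (h j)); rewrite ger_pMl.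
  by rewrite mxE normrM ger0_norm ?invr_ge0 ?(ltW s0) // ler_pdivrMl //; exact: h.
suff H k : (k <= T)%N -> X (loop x w k) /\
    (terX S (loop x w k) \/ value (loop x w k) <= C - k%:R * (eta / 2)).
  have [XT [//|VT]] := H T (leqnn T).
  by have := value_ge0 XT; move: VT hT; lra.
elim: k => [|k IH] kT; first by split=> //; right; rewrite mul0r subr0; exact: VC.
have [Xk hk] := IH (ltnW kT); have [Wz Wk] := small k kT.
split; first exact: control_invariant.
have [Xfk|nXfk] := pselect (terX S (loop x w k)).
  by left; exact: terminal_step.
case: hk => // hk; right => /=.
have := dec (loop x w k) s (s^-1 *: w k) Xk; rewrite scalerA divff ?gt_eqF // scale1r.
rewrite (ltW s0) s1 => /(_ isT Wz Wk).
have := etaQ _ (kappa (loop x w k)) nXfk.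
rewrite -[k.+1]addn1 natrD; move: hk sC; lra.
Qed.

End Fixed.
End Controller.

(** * The feasible set is closed *)

Section Entries.
Context {R : realType}.

Lemma cvg_entries {T : Type} (F : set_system T) n (f : T -> 'cV[R]_n) (l : 'cV[R]_n) :
  Filter F -> (forall i, (fun t => f t i 0) @ F --> l i 0) -> f @ F --> l.
Proof.
move=> FF h B [P hP sub].
have : \forall t \near F, forall i, P i 0 (f t i 0).
  by apply: filter_forall => i; exact: h (hP i 0).
by apply: filterS => t ht; apply: sub => i j; rewrite ord1; exact: ht.
Qed.

Lemma continuous_entries {T : topologicalType} n (f : T -> 'cV[R]_n) :
  (forall i, continuous (fun t => f t i 0)) -> continuous f.
Proof. by move=> h t; apply: cvg_entries => i; exact: h. Qed.

Lemma continuous_sum {T : topologicalType} (I : Type) (s : seq I) (Q : pred I)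
    (f : I -> T -> R) :
  (forall i, continuous (f i)) -> continuous (fun t => \sum_(i <- s | Q i) f i t).
Proof.
by move=> cf; apply: continuous_big => //; exact: add_continuous.
Qed.

Lemma continuous_coord {T : topologicalType} n (f : T -> 'cV[R]_n) i :
  continuous f -> continuous (fun t => f t i 0).
Proof.
move=> cf t; apply: (@continuous_comp _ _ _ f (fun M : 'cV[R]_n => M i 0) t (cf t)).
exact: coord_continuous.
Qed.

Lemma continuous_scale {T : topologicalType} (c : R) (f : T -> R) :
  continuous f -> continuous (fun t => c * f t).
Proof. by move=> cf t; apply: cvgM; [exact: cvg_cst | exact: cf]. Qed.

Lemma continuous_mulmx {T : topologicalType} n p (A : 'M[R]_(p, n)) (f : T -> 'cV[R]_n) :
  continuous f -> continuous (fun t => A *m f t).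
Proof.
move=> cf; apply: continuous_entries => i.
rewrite (_ : (fun t => _) = fun t => \sum_j A i j * f t j 0); last first.
  by apply/funext => t; rewrite mxE.
by apply: continuous_sum => j; apply: continuous_scale; exact: continuous_coord.
Qed.

Lemma continuous_add {T : topologicalType} {V : normedModType R} (f g : T -> V) :
  continuous f -> continuous g -> continuous (fun t => f t + g t).
Proof. by move=> cf cg t; apply: cvgD; [exact: cf | exact: cg]. Qed.

End Entries.

Section FeasibleClosed.
Context {R : realType} {n m q : nat} (S : mpc R n m q).
Local Notation N := (horizon S).
Local Notation vec k := 'cV[R]_k.
Local Notation W := (disW S).
Local Notation X := (feasible_set S).
Hypothesis Z_sub : conZ S `<=` [set z | inU S z.2].
Hypotheses (cZ : closed (conZ S)) (cX : closed (terX S)) (bU : bounded_set (inU S)).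
Hypotheses (W0 : W 0) (W_int : W° 0).

Let I : finType := ('I_N * 'I_N * 'I_m * 'I_q + 'I_N * 'I_m)%type.

(** Causal policies are given by finitely many real parameters. *)
Let decode (p : 'rV[R]_#|I|) : policy S :=
  ((fun i j : 'I_N => if (j < i)%N then
      \matrix_(a, b) p 0 (enum_rank (inl (i, j, a, b) : I)) else 0),
   fun i : 'I_N => \col_a p 0 (enum_rank (inr (i, a) : I))).

Let encode (th : policy S) : 'rV[R]_#|I| := \row_k
  match enum_val k : I with
  | inl (i, j, a, b) => th.1 i j a b
  | inr (i, a) => th.2 i a 0
  end.

Lemma encodeK th : causal th -> decode (encode th) = th.
Proof.
case: th => M v cM; congr pair.
  apply/funext => i; apply/funext => j; case: ltnP => ij; last by rewrite [RHS]cM.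
  by apply/matrixP => a b; rewrite !mxE enum_rankK.
by apply/funext => i; apply/colP => a; rewrite !mxE enum_rankK.
Qed.

Lemma decode_causal p : causal (decode p).
Proof. by move=> i j /= ij; rewrite ltnNge ij. Qed.

Lemma continuous_inp w k : continuous (fun p => inp (decode p) w k).
Proof.
rewrite /inp /ext0; case: insubP => [i _ _|_]; last exact: cst_continuous.
apply: continuous_entries => a.
pose g (p : 'rV[R]_#|I|) := p 0 (enum_rank (inr (i, a) : I)) +
    \sum_(j < N | (j < i)%N) \sum_b w j b 0 * p 0 (enum_rank (inl (i, j, a, b) : I)).
have -> : (fun p => input (decode p) (fun j : 'I_N => w j) i a 0) = g.
  apply/funext => p; rewrite /input mxE mxE summxE; congr (_ + _).
  apply: eq_bigr => j ji; rewrite mxE; apply: eq_bigr => b _.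
  by rewrite /= ji mxE mulrC.
have cp l : continuous (fun p : 'rV[R]_#|I| => p 0 l) by exact: coord_continuous.
apply: (@continuous_add _ _ R^o); first exact: cp.
by apply: continuous_sum => j; apply: continuous_sum => b; exact: continuous_scale.
Qed.

Lemma continuous_inp_fst w k :
  continuous (fun z : 'rV[R]_#|I| * vec n => inp (decode z.1) w k).
Proof.
move=> z; apply: (@continuous_comp _ _ _ fst (fun p => inp (decode p) w k) z).
  exact: cvg_fst.
exact: continuous_inp.
Qed.

Lemma continuous_sta w k : (k <= N)%N ->
  continuous (fun z : 'rV[R]_#|I| * vec n => sta z.2 (decode z.1) w k).
Proof.
elim: k => [|k IH] kN; first by move=> z; exact: cvg_snd.
have -> : (fun z : 'rV[R]_#|I| * vec n => sta z.2 (decode z.1) w k.+1) =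
  (fun z => sysA S *m sta z.2 (decode z.1) w k + sysB S *m inp (decode z.1) w k
    + sysG S *m w k) by apply/funext => z; rewrite staS.
apply: continuous_add; last exact: cst_continuous.
apply: continuous_add; apply: continuous_mulmx; first by apply: IH; exact: ltnW.
exact: continuous_inp_fst.
Qed.

(** The inputs of a feasible policy are bounded, and the disturbance set contains a
   multiple of each unit vector, which exposes each column of each block. *)
Lemma feasible_param_bound : exists C : R, forall x (th : policy S), feasible x th ->
  forall i, `|encode th 0 i| <= C.
Proof.
have [Cu Cu0 hu] := bounded_ebound bU; have [r r0 hr] := interior0_ebound W_int.
exists (Cu + 2 * Cu / r) => x th fx i.
have hin (w : 'I_N -> vec q) k : (forall j, W (w j)) -> ebound Cu (input th w k).
  by move=> Ww; have [hZ _] := fx.2 w Ww; apply: hu; exact: Z_sub (hZ k).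
have C2 : 0 <= 2 * Cu / r by rewrite divr_ge0 ?mulr_ge0 // ltW.
rewrite mxE; case: (enum_val i) => [[[[k j] a] b]|[k a]]; last first.
  have /(_ a) := hin (fun=> 0) k (fun=> W0).
  rewrite /input big1 ?addr0 => [h|j _]; last by rewrite mulmx0.
  by rewrite (le_trans h) // lerDl.
have [jk|jk] := ltnP j k; last by rewrite fx.1 // mxE normr0 addr_ge0.
(* Changing the noise from [0] to [e] moves the input by [r] times a column of [M(k, j)]. *)
pose e j' : vec q := if j' == j then r *: delta_mx b 0 else 0.
have We j' : W (e j').
  rewrite /e; case: eqP => // _; apply: hr => c; rewrite !mxE andbT.
  by case: (c == b); rewrite ?mulr1 ?mulr0 ?normr0 ?(ltW r0) // gtr0_norm.
have /(_ a) h1 := hin e k We; have /(_ a) h0 := hin (fun=> 0) k (fun=> W0).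
have E : input th e k = input th (fun=> 0) k + r *: (th.1 k j *m delta_mx b 0).
  rewrite /input -addrA; congr (_ + _).
  rewrite (bigD1 j) //= [X in _ = X + _]big1 ?add0r => [|j' _]; last by rewrite mulmx0.
  rewrite big1 ?addr0 => [|j' /andP[_ /negPf j'j]]; last by rewrite /e j'j mulmx0.
  by rewrite /e eqxx -scalemxAr.
have E2 : r * th.1 k j a b = input th e k a 0 - input th (fun=> 0) k a 0.
  by rewrite E mxE addrAC subrr add0r mxE -colE mxE.
have : r * `|th.1 k j a b| <= 2 * Cu.
  rewrite -[X in X * _](gtr0_norm r0) -normrM E2 (le_trans (ler_normB _ _)) //.
  by rewrite mulr2n mulrDl !mul1r lerD.
by rewrite mulrC -ler_pdivlMr // => /le_trans; apply; rewrite lerDr.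
Qed.

(** Feasibility is a closed condition on the state and the policy together, and the
   policies that are feasible anywhere form a bounded set: the projection on the state
   is closed. *)
Lemma feasible_set_closed : closed X.
Proof.
have [C hC] := feasible_param_bound.
pose A : set 'rV[R]_#|I| := [set p | forall i, `[- C, C]%classic (p 0 i)].
have cA : compact A.
  by apply: (@rV_compact R #|I| (fun=> `[- C, C]%classic)) => i; exact: segment_compact.
rewrite -[X]setCK; apply: open_closedC; rewrite openE => x0 nX.
have fxA x : X x -> exists2 p, A p & feasible x (decode p).
  move=> [th fx]; exists (encode th); last by rewrite encodeK //; exact: fx.1.
  by move=> i /=; rewrite in_itv /= -ler_norml; exact: hC fx i.
have H p : A p -> \forall p' \near p & x \near x0, ~ feasible x (decode p').
  move=> _; have nf : ~ feasible x0 (decode p) by move=> fx; apply: nX; exists (decode p).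
  have [w [Ww bad]] : exists w : nat -> vec q, (forall i, W (w i)) /\
      ~ ((forall k, (k < N)%N -> conZ S (sta x0 (decode p) w k, inp (decode p) w k)) /\
        terX S (sta x0 (decode p) w N)).
    apply: contrapT => h; apply: nf; apply/feasibleP => //; split.
      exact: decode_causal.
    by move=> w Ww; apply: contrapT => h'; apply: h; exists w.
  have [[k [kN nZ]]|nXf] : (exists k, (k < N)%N /\
      ~ conZ S (sta x0 (decode p) w k, inp (decode p) w k)) \/
      ~ terX S (sta x0 (decode p) w N).
    apply: contrapT => /not_orP[h1 /contrapT h2]; apply: bad; split=> // k kN.
    by apply: contrapT => nZ; apply: h1; exists k.
  - have cs := @continuous_sta w k (ltnW kN) (p, x0).
    have ci := @continuous_inp_fst w k (p, x0).
    have cp : (sta z.2 (decode z.1) w k, inp (decode z.1) w k) @[z --> (p, x0)] -->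
        (sta x0 (decode p) w k, inp (decode p) w k).
      exact: (cvg_pair cs ci).
    have : \forall z \near (p, x0), (~` conZ S) (sta z.2 (decode z.1) w k, inp (decode z.1) w k).
      by apply: cp; apply: open_nbhs_nbhs; split=> //; exact: closed_openC.
    apply: filterS => -[p' x'] /= nZ' /(feasibleP _ _ W0)[_ /(_ w Ww)[hZ _]].
    by apply: nZ'; exact: hZ.
  - have cs := @continuous_sta w N (leqnn N) (p, x0).
    have : \forall z \near (p, x0), (~` terX S) (sta z.2 (decode z.1) w N).
      by apply: cs; apply: open_nbhs_nbhs; split=> //; exact: closed_openC.
    apply: filterS => -[p' x'] /= nX' /(feasibleP _ _ W0)[_ /(_ w Ww)[_ hX]].
    exact: nX'.
have /compact_near_coveringP/(_ _ (nbhs x0) (fun x p => ~ feasible x (decode p))) := cA.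
move=> /(_ _ H); apply: filterS => x sub Xx.
by have [p Ap fx] := fxA x Xx; exact: sub Ap fx.
Qed.

End FeasibleClosed.

(** * Integrals of nonmeasurable functions *)

Section NonmeasurableIntegral.
Context {d} {T : measurableType d} {R : realType} (mu : {measure set T -> \bar R}).
Local Open Scope ereal_scope.
Import HBNNSimple.

(** The integral of a nonnegative function, measurable or not, is a supremum over simple
   functions below it, and these may be restricted to the complement of a null set. *)
Lemma ge0_le_integral_off_null (f g : T -> \bar R) (N : set T) :
  (forall x, 0 <= f x) -> (forall x, 0 <= g x) -> measurable N -> mu N = 0 ->
  (forall x, ~ N x -> f x <= g x) -> \int[mu]_x f x <= \int[mu]_x g x.
Proof.
move=> f0 g0 mN N0 fg; rewrite !ge0_integralTE //.
apply: ge_ereal_sup => _ [h hf <-].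
have mNc := measurableC mN.
apply: (@le_trans _ _ (sintegral mu (proj_nnsfun h mNc))).
  rewrite -!integralT_nnsfun le_eqVlt; apply/orP; left; apply/eqP.
  apply: ge0_ae_eq_integral => //.
  - by apply/measurable_EFinP.
  - by apply/measurable_EFinP.
  - by move=> x _; rewrite lee_fin.
  - by move=> x _; rewrite lee_fin.
  exists N; split=> // x /=; apply: contra_notP => nNx _.
  by rewrite mindicE mem_set // mulr1.
apply: ereal_sup_ubound; exists (proj_nnsfun h mNc) => //= x.
rewrite mindicE; have [Nx|nNx] := pselect (N x).
  by rewrite memNset ?mulr0 // => /(_ Nx).
by rewrite mem_set // mulr1 (le_trans (hf x)) // fg.
Qed.

Lemma ge0_eq_integral_off_null (f g : T -> \bar R) (N : set T) :
  (forall x, 0 <= f x) -> (forall x, 0 <= g x) -> measurable N -> mu N = 0 ->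
  (forall x, ~ N x -> f x = g x) -> \int[mu]_x f x = \int[mu]_x g x.
Proof.
move=> f0 g0 mN N0 fg; apply/eqP; rewrite eq_le; apply/andP.
by split; apply: (ge0_le_integral_off_null _ _ mN) => // x /fg ->.
Qed.

End NonmeasurableIntegral.

(** * Long-term average cost *)

Lemma closed_loop_ext {R : realType} {n m q} (S : mpc R n m q) kappa x w w' k :
  (forall j, (j < k)%N -> w j = w' j) ->
  closed_loop S kappa x w k = closed_loop S kappa x w' k.
Proof.
elim: k => [//|k IH] ww /=; rewrite IH ?ww // => j jk; apply: ww.
exact: ltnW.
Qed.

Lemma closed_loopD {R : realType} {n m q} (S : mpc R n m q) kappa x w i k :
  closed_loop S kappa x w (i + k) =
  closed_loop S kappa (closed_loop S kappa x w i) (fun j => w (i + j)%N) k.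
Proof. by elim: k => [|k IH]; rewrite ?addn0 // addnS /= IH. Qed.

Section LoopStatistics.
Context {R : realType} {n m q : nat} (S : mpc R n m q).
Local Notation N := (horizon S).
Local Notation vec k := 'cV[R]_k.
Local Notation K := (gainK S).
Local Notation W := (disW S).
Local Notation X := (feasible_set S).
Local Notation fam := (famB nat R q).
Hypotheses (cW : closed W) (bW : bounded_set W) (bU : bounded_set (inU S)) (W0 : W 0).
Hypotheses (pQ : psd (wgtQ S)) (pR : pd (wgtR S)) (pP : psd (wgtP S)).
Hypothesis ric : riccati S.
Context (kappa : vec n -> vec m) (x0 : vec n) (Xx0 : X x0).
Local Notation loop := (closed_loop S kappa x0).
Hypothesis mX : measurable (X : set (vecB R n)).
Hypothesis mk : measurable_fun (X : set (vecB R n)) (kappa : vecB R n -> vecB R m).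
Hypothesis kU : forall x, X x -> inU S (kappa x).
Hypothesis Xinv : forall x z, X x -> W z ->
  X (sysA S *m x + sysB S *m kappa x + sysG S *m z).
Hypothesis loop_bounded : exists b : R, forall w k, (forall i, W (w i)) ->
  ebound b (loop w k).
Context (P : probability fam R) (P0 : probability (vecB R q) R).
Hypotheses (nP : noise W P) (mP : forall k, has_marginal P k P0).

(** Noise cut off at [W], a modification on a null set that keeps the state in the domain
   of the control law along every noise sequence. *)
Definition clip (z : vec q) : vec q := if z \in W then z else 0.

Lemma clip_in z : W (clip z).
Proof. by rewrite /clip; case: ifP => // /set_mem. Qed.

Lemma clip_id z : W z -> clip z = z.
Proof. by move=> Wz; rewrite /clip mem_set. Qed.

Lemma measurable_clip : measurable_fun setT (clip : vecB R q -> vecB R q).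
Proof.
apply: measurable_fun_ifT => //.
apply: (@measurable_fun_bool _ _ _ _ true).
have -> : setT `&` (fun z : vecB R q => z \in W) @^-1` [set true] = W.
  by apply/seteqP; split=> z /=; [move=> [_ /set_mem] | move=> Wz; split=> //; exact: mem_set].
exact: closed_measurable_vecB.
Qed.

Definition cloop (w : fam) (k : nat) : vec n := loop (fun j => clip (w j)) k.

Lemma cloop_feasible w k : X (cloop w k).
Proof. by elim: k => [//|k IH]; exact: Xinv IH (clip_in _). Qed.

Lemma cloop_past w k : cloop (past k w) k = cloop w k.
Proof. by apply: closed_loop_ext => j jk; rewrite /past jk. Qed.

Lemma measurable_clip_coord k :
  measurable_fun setT (fun w : fam => clip (w k) : vecB R q).
Proof. by apply: (measurableT_comp measurable_clip); exact: measurable_fam_coord. Qed.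

Lemma measurable_control {d} {T : measurableType d} (f : T -> vec n) :
  (forall t, X (f t)) -> measurable_fun setT (f : T -> vecB R n) ->
  measurable_fun setT (fun t => kappa (f t) : vecB R m).
Proof.
move=> Xf mf; have mk' := (measurable_restrictT (kappa : vecB R n -> vecB R m) mX).1 mk.
rewrite (_ : (fun t => _) = ((kappa : vecB R n -> vecB R m) \_ X) \o (f : T -> vecB R n)).
  exact: measurableT_comp mk' mf.
by apply/funext => t; rewrite /= patchE mem_set.
Qed.

Lemma measurable_cloop k : measurable_fun setT ((fun w => cloop w k) : fam -> vecB R n).
Proof.
elim: k => [|k IH]; first exact: measurable_cst.
apply: measurable_vecD.
  2: by apply: measurable_vec_mul; exact: measurable_clip_coord.
apply: measurable_vecD; apply: measurable_vec_mul => //.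
by apply: measurable_control IH => w; exact: cloop_feasible.
Qed.

Lemma measurable_cloop_control k :
  measurable_fun setT (fun w => kappa (cloop w k) : vecB R m).
Proof.
by apply: measurable_control (measurable_cloop k) => w; exact: cloop_feasible.
Qed.

Lemma vbounded_ebound p (f : fam -> vec p) (b : R) :
  measurable_fun setT (f : fam -> vecB R p) -> (forall w, ebound b (f w)) -> vbounded P f.
Proof.
move=> /measurable_vecP mf hf a; split; first exact: mf.
by exists b; apply: aeW => w; exact: hf.
Qed.

Lemma vbounded_cloop k : vbounded P (fun w => cloop w k).
Proof.
have [b hb] := loop_bounded; apply: (@vbounded_ebound _ _ b).
  exact: measurable_cloop.
by move=> w; apply: hb => i; exact: clip_in.
Qed.

Lemma vbounded_control k : vbounded P (fun w => kappa (cloop w k)).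
Proof.
have [b _ hb] := bounded_ebound bU; apply: (@vbounded_ebound _ _ b).
  exact: measurable_cloop_control.
by move=> w; apply/hb/kU; exact: cloop_feasible.
Qed.

Lemma vbounded_clip k : vbounded P (fun w => clip (w k)).
Proof.
have [b _ hb] := bounded_ebound bW; apply: (@vbounded_ebound _ _ b).
  exact: measurable_clip_coord.
by move=> w; apply/hb; exact: clip_in.
Qed.

Definition cdrift (w : fam) k : vec n :=
  sysA S *m cloop w k + sysB S *m kappa (cloop w k).

Lemma vbounded_cdrift k : vbounded P (fun w => cdrift w k).
Proof.
apply: vboundedD; apply: vbounded_mul; [exact: vbounded_cloop | exact: vbounded_control].
Qed.

Lemma measurable_cdrift k : measurable_fun setT ((fun w => cdrift w k) : fam -> vecB R n).
Proof.
apply: measurable_vecD; apply: measurable_vec_mul;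
  [exact: measurable_cloop | exact: measurable_cloop_control].
Qed.

(** The state depends on the past noise only, with which the present noise is
   uncorrelated. *)
Lemma mean_cdrift k (M : 'M[R]_(n, q)) :
  mean P (fun w => bil M (cdrift w k) (clip (w k))) = 0.
Proof.
rewrite mean_bil; [|exact: vbounded_cdrift|exact: vbounded_clip].
rewrite big1 // => a _; rewrite big1 // => b _; rewrite (_ : mean P _ = 0) ?mulr0 //.
rewrite -[RHS](@noise_past _ _ W P k b (fun w => cdrift w k a 0) cW bW nP).
- apply: mean_ae_eq.
  + by apply: asboundedM; [exact: vbounded_cdrift | exact: vbounded_clip].
  + apply: asboundedM; last exact: (asbounded_noise cW bW nP).
    have := vbounded_cdrift k a; apply: asbounded_ext => w.
    by rewrite /cdrift cloop_past.
  apply: (ae_mono _ (noise_in cW nP k)) => w Ww.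
  by rewrite clip_id // /cdrift cloop_past.
- exact: (measurable_vecP _).1 (measurable_cdrift k) a.
- have := vbounded_cdrift k a; apply: asbounded_ext => w.
  by rewrite /= /cdrift cloop_past.
Qed.

Definition step_noise_cost : R := mean P0 (fun z => quad (wgtP S) (sysG S *m clip z)).

Lemma mean_clip_noise k :
  mean P (fun w => quad (wgtP S) (sysG S *m clip (w k))) = step_noise_cost.
Proof.
have mi : measurable_fun setT (fun w : fam => w k : vecB R q).
  exact: measurable_fam_coord.
pose f (z : vecB R q) : R := quad (wgtP S) (sysG S *m clip z).
have mf : measurable_fun setT f.
  have mg := measurable_vec_mul (sysG S) measurable_clip.
  exact: (measurable_bil _ mg mg).
have bf : asbounded (law P mi) f.
  apply: (asbounded_lawI mi mf).
  exact: (asbounded_quad (wgtP S) (vbounded_mul (sysG S) (vbounded_clip k))).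
rewrite -[LHS](mean_law bf) /step_noise_cost /mean; congr fine.
apply: eq_measure_integral => A mA _; exact: mP.
Qed.

Definition cexcess k : R :=
  mean P (fun w => quad (wgtS S) (kappa (cloop w k) - K *m cloop w k)).

Lemma vbounded_cerr k : vbounded P (fun w => kappa (cloop w k) - K *m cloop w k).
Proof.
apply: vboundedD; first exact: vbounded_control.
by apply: vboundedN; apply: vbounded_mul; exact: vbounded_cloop.
Qed.

Definition cstage k (w : fam) : R := stage S (cloop w k) (kappa (cloop w k)).

Lemma asbounded_cstage k : asbounded P (cstage k).
Proof.
by apply: asboundedD; apply: asbounded_quad; [exact: vbounded_cloop | exact: vbounded_control].
Qed.

(** The first difference telescopes over time; the other two terms are the penalty and the
   cost of the noise. *)
Lemma mean_cstage k : mean P (cstage k) =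
  mean P (fun w => quad (wgtP S) (cloop w k)) -
  mean P (fun w => quad (wgtP S) (cloop w k.+1)) + cexcess k + step_noise_cost.
Proof.
pose M := wgtP S *m sysG S.
have E w : cstage k w = quad (wgtP S) (cloop w k) - quad (wgtP S) (cloop w k.+1)
    + quad (wgtS S) (kappa (cloop w k) - K *m cloop w k)
    + 2 * bil M (cdrift w k) (clip (w k)) + quad (wgtP S) (sysG S *m clip (w k)).
  by rewrite /cstage (stage_step pR pP ric _ _ (clip (w k))) bil_mulr.
rewrite (mean_ext P E).
have b1 := asbounded_quad (wgtP S) (vbounded_cloop k).
have b2 := asbounded_quad (wgtP S) (vbounded_cloop k.+1).
have b3 := asbounded_quad (wgtS S) (vbounded_cerr k).
have b4 := asbounded_bil M (vbounded_cdrift k) (vbounded_clip k).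
have b5 := asbounded_quad (wgtP S) (vbounded_mul (sysG S) (vbounded_clip k)).
have b12 := asboundedB b1 b2; have b123 := asboundedD b12 b3.
have b4' := asboundedZ 2 b4; have b1234 := asboundedD b123 b4'.
rewrite (meanD b1234 b5) (meanD b123 b4') (meanD b12 b3) (meanB b1 b2) (meanZ _ b4).
by rewrite mean_cdrift mulr0 addr0 mean_clip_noise.
Qed.

Lemma avg_perfE k : avg_perf S kappa k x0 P =
  (k%:R^-1 * (quad (wgtP S) x0 - mean P (fun w => quad (wgtP S) (cloop w k))
    + \sum_(i < k) cexcess i) + k%:R^-1 * k%:R * step_noise_cost)%:E.
Proof.
have Wall : {ae P, forall w, forall i, W (w i)}.
  by apply: ae_forall_nat => i; exact: noise_in.
have [Nu [mN N0 hN]] := Wall.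
pose g (w : fam) : R := k%:R^-1 * \sum_(i < k) cstage i w.
have bs : asbounded P (fun w => \sum_(i < k) cstage i w).
  by apply: asbounded_sum => i _; exact: asbounded_cstage.
have bg : asbounded P g by exact: asboundedZ.
have -> : avg_perf S kappa k x0 P = (\int[P]_w (g w)%:E)%E.
  rewrite /avg_perf unlock; apply: (ge0_eq_integral_off_null _ _ mN N0) => w.
  - rewrite lee_fin mulr_ge0 ?invr_ge0 // sumr_ge0 // => i _.
    exact: (stage_ge0 pQ pR).
  - rewrite lee_fin mulr_ge0 ?invr_ge0 // sumr_ge0 // => i _.
    exact: (stage_ge0 pQ pR).
  move=> nNw; have Ww : forall i, W (w i) by apply: contrapT => h; apply: nNw; exact: hN.
  have E i : closed_loop S kappa x0 w i = cloop w i.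
    by apply: closed_loop_ext => j _; rewrite clip_id.
  by congr (_ * _)%:E; apply: eq_bigr => i _; rewrite E.
rewrite (meanE bg); congr EFin; rewrite meanZ // -mulrA -mulrDr; congr (_ * _).
rewrite mean_sum => [|i _]; last exact: asbounded_cstage.
rewrite (eq_bigr _ (fun (i : 'I_k) _ => mean_cstage i)) big_split /= big_split /=.
rewrite sumr_const card_ord.
congr (_ + _ + _); last by rewrite mulr_natl.
rewrite -(big_mkord xpredT (fun i => mean P (fun w => quad (wgtP S) (cloop w i)) +
  - mean P (fun w => quad (wgtP S) (cloop w i.+1)))).
under eq_bigr do rewrite -opprB.
rewrite sumrN telescope_sumr // opprB; congr (_ - _).
by rewrite -[RHS](mean_cst P).
Qed.

Lemma avg_perf_cvg : (exists D : R, forall k, \sum_(i < k) cexcess i <= D) ->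
  avg_perf S kappa k x0 P @[k --> \oo] --> (step_noise_cost)%:E.
Proof.
move=> [D hD]; have [b hb] := loop_bounded.
have [c c0 hc] := quad_ebound (wgtP S) b.
have e0 k : 0 <= \sum_(i < k) cexcess i.
  apply: sumr_ge0 => i _; apply: mean_ge; first exact/asbounded_quad/vbounded_cerr.
  by apply: aeW => w; exact: wgtS_ge0.
have m0 k : 0 <= mean P (fun w => quad (wgtP S) (cloop w k)) <= c.
  have bq := asbounded_quad (wgtP S) (vbounded_cloop k).
  apply/andP; split; first by apply: mean_ge => //; apply: aeW => w; exact: pP.2.
  by apply: mean_bound => //; apply: aeW => w; apply/hc/hb => i; exact: clip_in.
pose g k := quad (wgtP S) x0 - mean P (fun w => quad (wgtP S) (cloop w k))
    + \sum_(i < k) cexcess i.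
pose r k := k%:R^-1 * g k + k%:R^-1 * k%:R * step_noise_cost.
have -> : (fun k => avg_perf S kappa k x0 P) = EFin \o r.
  by apply/funext => k; rewrite avg_perfE.
apply: cvg_EFin; first exact: nearW.
rewrite -(cvg_shiftS r).
have H a : step_noise_cost + a * harmonic k @[k --> \oo] --> step_noise_cost.
  rewrite -[X in _ --> X]addr0 -[X in _ --> _ + X](mulr0 a).
  apply: cvgD; first exact: cvg_cst.
  by apply: cvgM; [exact: cvg_cst | exact: cvg_harmonic].
apply: (squeeze_cvgr _ (H (- c)) (H (quad (wgtP S) x0 + D))); apply: nearW => k /=.
rewrite /r mulVf ?pnatr_eq0 // mul1r; set h : R := (k.+1)%:R^-1.
have h0 : 0 <= h by rewrite invr_ge0.
have hg : - c <= g k.+1 <= quad (wgtP S) x0 + D.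
  rewrite /g; have := e0 k.+1; have := hD k.+1; have /andP[] := m0 k.+1.
  by have := pP.2 x0; lra.
move: hg => /andP[g1 g2].
have h1 : 0 <= (g k.+1 + c) * h by rewrite mulr_ge0 //; lra.
have h2 : 0 <= (quad (wgtP S) x0 + D - g k.+1) * h by rewrite mulr_ge0 //; lra.
by apply/andP; split; lra.
Qed.

(** * Reaching the terminal set *)

Section HittingTime.
Hypothesis cXf : closed (terX S).
Hypothesis XfK : forall x, terX S x -> kappa x = K *m x.
Hypothesis Xf_step : forall x z, terX S x -> W z ->
  terX S (sysA S *m x + sysB S *m kappa x + sysG S *m z).
Context (eps : R) (T : nat) (eps0 : 0 < eps).
Hypothesis hit : forall x w, X x -> (forall i, (i < T)%N -> enorm (w i) <= eps) ->
  terX S (closed_loop S kappa x w T).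
Let small : set (vecB R q) := [set w : vecB R q | (enorm (w : 'cV[R]_q) <= eps)%R].
Hypothesis small_pos : (0 < P0 small)%E.

Definition outside k : set fam := [set w | ~ terX S (cloop w k)].

Lemma measurable_outside k : measurable (outside k).
Proof.
have mXf : measurable (~` terX S : set (vecB R n)).
  by apply: measurableC; exact: closed_measurable_vecB.
by have := measurable_cloop k measurableT mXf; rewrite setTI.
Qed.

Lemma measurable_small : measurable small.
Proof.
have -> : small = (fun z : vecB R q => bil (1%:M : 'M[R]_q) (z : vec q) (z : vec q))
    @^-1` `]-oo, eps ^+ 2].
  apply/funext => z; rewrite /small /= in_itv /= /enorm; congr is_true.
  rewrite -{1}(ger0_norm (ltW eps0)) -sqrtr_sqr ler_sqrt ?sqr_ge0 //.
  congr (_ <= _); rewrite /bil mulmx1 mxE; apply: eq_bigr => k _.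
  by rewrite mxE expr2.
have mid : measurable_fun setT (id : vecB R q -> vecB R q) by exact: measurable_id.
rewrite -[X in measurable X]setTI.
by apply: (measurable_bil _ mid mid).
Qed.

(** Each further term of the noise is independent of the state at time [i] and of the
   terms in between. *)
Lemma prob_small_run i t :
  P (outside i `&` [set w : fam | forall j, (j < t)%N -> small (w (i + j)%N)]) =
  (P (outside i) * (P0 small) ^+ t)%E.
Proof.
elim: t => [|t IH].
  rewrite expe0 mule1; congr (P _); apply/seteqP; split=> w; first by case.
  by move=> h; split.
pose A := outside i `&` [set w : fam | forall j, (j < t)%N -> small (w (i + j)%N)].
have mA : measurable A.
  apply: measurableI; first exact: measurable_outside.
  have -> : [set w : fam | forall j, (j < t)%N -> small (w (i + j)%N)] =
      \bigcap_(j in `I_t) [set w : fam | small (w (i + j)%N)] by [].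
  apply: bigcap_measurableType => j _.
  by apply: measurable_coord_preimage; exact: measurable_small.
have pA : past (i + t) @^-1` A = A.
  have E w : cloop (past (i + t) w) i = cloop w i.
    by apply: closed_loop_ext => j ji; rewrite /past (leq_trans ji) ?leq_addr.
  by apply/seteqP; split=> w [h1 h2]; split=> [|j jt];
    move: h1; rewrite /outside /= ?E // => _; have := h2 j jt;
    rewrite /past ltn_add2l jt.
have := @past_indep _ _ _ nP.1 (i + t)%N _ _ mA measurable_small.
rewrite pA IH (mP _ measurable_small) expeS (muleC (P0 small)) muleA => <-.
congr (P _); apply/seteqP; split=> w /=.
  move=> [h1 h2]; split; last exact: h2.
  by split=> // j jt; apply: h2; exact: ltnW.
move=> [[h1 h2] h3]; split=> // j; rewrite ltnS leq_eqVlt => /orP[/eqP->//|].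
exact: h2.
Qed.

Definition pout k : R := fine (P (outside k)).

Lemma poutE k : (P (outside k) = (pout k)%:E)%E.
Proof. by rewrite /pout fineK // fin_num_measure //; exact: measurable_outside. Qed.

(** Being outside at time [i + T] excludes a run of small disturbances from time [i], by
   the choice of [T], and excludes having been inside at time [i], by invariance. *)
Lemma pout_decrease i : pout (i + T) + pout i * fine (P0 small) ^+ T <= pout i.
Proof.
pose D := outside i `&` [set w : fam | forall j, (j < T)%N -> small (w (i + j)%N)].
have mD : measurable D.
  apply: measurableI; first exact: measurable_outside.
  have -> : [set w : fam | forall j, (j < T)%N -> small (w (i + j)%N)] =
      \bigcap_(j in `I_T) [set w : fam | small (w (i + j)%N)] by [].
  apply: bigcap_measurableType => j _.
  by apply: measurable_coord_preimage; exact: measurable_small.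
have PD : P D = (pout i * fine (P0 small) ^+ T)%:E.
  have f : ((fine (P0 small))%:E = P0 small)%E.
    by rewrite fineK // fin_num_measure //; exact: measurable_small.
  by rewrite prob_small_run poutE EFinM EFin_expe f.
rewrite -lee_fin EFinD -poutE -PD -poutE -measureU //; last 2 first.
  exact: measurable_outside.
  apply/seteqP; split=> // w [] hout [_ hs]; apply: hout.
  rewrite /cloop closed_loopD; apply: hit; first exact: cloop_feasible.
  move=> j jT; have /= := hs j jT; rewrite /clip; case: ifP => // _ _.
  rewrite /enorm big1 ?sqrtr0 ?(ltW eps0) // => k _.
  by rewrite mxE expr0n.
apply: le_measure; rewrite ?inE.
- by apply: measurableU => //; exact: measurable_outside.
- exact: measurable_outside.
move=> w [hout|[]//]; apply: contra_not hout => hXf.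
elim: T => [|t IH]; first by rewrite addn0.
by rewrite addnS; apply: Xf_step IH (clip_in _).
Qed.

Lemma pout_ge0 k : 0 <= pout k.
Proof. by rewrite fine_ge0. Qed.

Lemma pout_le1 k : pout k <= 1.
Proof.
by rewrite -lee_fin -poutE; apply: probability_le1; exact: measurable_outside.
Qed.

(** The decrease of [pout] over [T] steps, summed over time, telescopes to at most the
   first [T] terms, each of which is at most [1]. *)
Lemma pout_sum k : \sum_(i < k) pout i <= T%:R / fine (P0 small) ^+ T.
Proof.
have b0 : 0 < fine (P0 small).
  rewrite fine_gt0 // small_pos -ge0_fin_numE //.
  by rewrite fin_num_measure //; exact: measurable_small.
rewrite ler_pdivlMr ?exprn_gt0 // mulr_suml.
have h i : pout i * fine (P0 small) ^+ T <= pout i - pout (i + T).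
  by have := pout_decrease i; lra.
apply: (@le_trans _ _ (\sum_(i < k) (pout i - pout (i + T)))).
  by apply: ler_sum => i _; exact: h.
have sE t : \sum_(i < k + t) pout i = \sum_(i < t) pout i + \sum_(i < k) pout (i + t).
  by rewrite addnC big_split_ord /=; congr (_ + _); apply: eq_bigr => i _; rewrite addnC.
have : \sum_(i < k) pout i <= \sum_(i < k + T) pout i.
  rewrite big_split_ord /= lerDl; apply: sumr_ge0 => i _; exact: pout_ge0.
have : \sum_(i < T) pout i <= T%:R.
  rewrite -[X in _ <= X%:R]card_ord -sumr_const; apply: ler_sum => i _.
  exact: pout_le1.
by rewrite sE sumrB; lra.
Qed.

(** The penalty is bounded, and it vanishes on the terminal set. *)
Lemma cexcess_sum : exists D : R, forall k, \sum_(i < k) cexcess i <= D.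
Proof.
have [b hb] := loop_bounded; have [bu _ hu] := bounded_ebound bU.
have [bK hK] := ebound_mul (- K) b.
have [C C0 hC] := quad_ebound (wgtS S) (bu + bK).
exists (C * (T%:R / fine (P0 small) ^+ T)) => k.
apply: (le_trans _ (ler_wpM2l C0 (pout_sum k))).
rewrite mulr_sumr; apply: ler_sum => i _; rewrite /pout -mean_indic; last first.
  exact: measurable_outside.
have mo := measurable_outside i.
rewrite -meanZ; last exact: asbounded_indic.
apply: mean_le.
- exact/asbounded_quad/vbounded_cerr.
- by apply: asboundedZ; exact: asbounded_indic.
apply: aeW => w; have [Xfw|nXfw] := pselect (terX S (cloop w i)).
  by rewrite XfK // subrr quad0 indicE; case: (_ \in _); rewrite ?mulr1 ?mulr0.
rewrite indicE mem_set // mulr1; apply: hC; rewrite -mulNmx; apply: eboundD.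
  by apply/hu/kU; exact: cloop_feasible.
by apply/hK/hb => j; exact: clip_in.
Qed.

End HittingTime.
End LoopStatistics.

(** * Convergence of the average cost *)

Section LyapunovBound.
Context {R : realType} {n m q : nat} (S : mpc R n m q).
Local Notation K := (gainK S).
Local Notation W := (disW S).
Hypotheses (bW : bounded_set W).
Hypotheses (Q_pd : pd (wgtQ S)) (pR : pd (wgtR S)) (P_pd : pd (wgtP S)).
Hypothesis ric : riccati S.

(** The terminal cost is a Lyapunov function: under the gain it contracts, because it is
   dominated by the stage cost, so that bounded noise keeps it bounded. *)
Lemma gain_loop_bounded kappa x : (forall y, kappa y = K *m y) ->
  exists b : R, forall w k, (forall i, W (w i)) -> ebound b (closed_loop S kappa x w k).
Proof.
move=> kK; have pP := pd_psd P_pd; have sP := pP.1.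
have [c c0 hc] := pd_coord_le Q_pd; have [c1 c10 hc1] := quad_le (wgtP S).
have [cw _ hcw] := bounded_ebound bW; have [cg hcg] := ebound_mul (sysG S) cw.
have [cG cG0 hcG] := quad_ebound (wgtP S) cg.
have [cp cp0 hcp] := pd_coord_le P_pd.
pose ga : R := (c1 * c + 1)^-1.
have cc : 0 <= c1 * c by rewrite mulr_ge0.
have ga0 : 0 < ga by rewrite invr_gt0 ltr_wpDl.
have ga1 : ga <= 1 by rewrite invf_le1 ?ltr_wpDl // lerDr.
have contr y : quad (wgtP S) ((sysA S + sysB S *m K) *m y) <=
    (1 - ga) * quad (wgtP S) y.
  have := stage_riccati pR pP ric y (K *m y); rewrite subrr quad0 addr0.
  rewrite mulmxDl -mulmxA => E.
  have h1 : quad (wgtP S) y <= c1 * (c * quad (wgtQ S) y) by apply: hc1 => i; exact: hc.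
  have q0 : 0 <= quad (wgtQ S) y by exact: (pd_psd Q_pd).2.
  have r0 : 0 <= quad (wgtR S) (K *m y) by exact: (pd_psd pR).2.
  have h2 : ga * quad (wgtP S) y <= quad (wgtQ S) y.
    by rewrite /ga ler_pdivrMl ?ltr_wpDl // mulrDl mul1r -mulrA (le_trans h1) // lerDl.
  by move: E; rewrite /stage; lra.
(* [M] is preserved by [v |-> (1 - ga ^ 2) v + (1 + 1 / ga) cG], the bound obtained for
   one step from the contraction and Young's inequality. *)
pose M := Num.max (quad (wgtP S) x) ((1 + ga^-1) * cG / ga ^+ 2).
have M0 : 0 <= M by rewrite le_max pP.2.
suff H w k : (forall i, W (w i)) -> quad (wgtP S) (closed_loop S kappa x w k) <= M.
  exists (cp * M + 1) => w k Ww i; set y := closed_loop _ _ _ _ _.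
  have h1 := hcp y i; have h2 : cp * quad (wgtP S) y <= cp * M by rewrite ler_wpM2l // H.
  rewrite -[y i 0 ^+ 2]real_normK ?num_real // in h1.
  (* [t <= t ^ 2 + 1] for the entry [t]. *)
  have h3 : 0 <= (`|y i 0| - 2^-1) ^+ 2 by exact: sqr_ge0.
  by nra.
move=> Ww; elim: k => [|k IH] /=; first by rewrite le_max lexx.
set y := closed_loop S kappa x w k in IH *; rewrite kK mulmxA -mulmxDl.
set z := _ *m y; set g := sysG S *m w k.
have hz : quad (wgtP S) z <= (1 - ga) * M.
  by apply: (le_trans (contr y)); rewrite ler_wpM2l // subr_ge0.
have hg : quad (wgtP S) g <= cG by apply/hcG/hcg/hcw.
have young : 2 * bil (wgtP S) z g <= ga * quad (wgtP S) z + ga^-1 * quad (wgtP S) g.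
  have := pP.2 (ga *: z - g); rewrite quadD // quadZ bilNr bilZl.
  rewrite (_ : quad _ (- g) = quad (wgtP S) g); last by rewrite -scaleN1r quadZ; ring.
  move=> h.
  have h' : 0 <= ga^-1 * (ga ^+ 2 * quad (wgtP S) z - 2 * (ga * bil (wgtP S) z g) +
     quad (wgtP S) g) by rewrite mulr_ge0 ?invr_ge0 ?(ltW ga0) //; lra.
  have E : ga^-1 * (ga ^+ 2 * quad (wgtP S) z - 2 * (ga * bil (wgtP S) z g) +
     quad (wgtP S) g) = ga * quad (wgtP S) z - 2 * bil (wgtP S) z g + ga^-1 * quad (wgtP S) g.
    by field; rewrite gt_eqF.
  by rewrite E in h'; lra.
have hM : (1 + ga^-1) * cG <= ga ^+ 2 * M.
  by rewrite [leRHS]mulrC -ler_pdivrMr ?exprn_gt0 // le_max lexx orbT.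
have gi : 0 <= ga^-1 by rewrite invr_ge0 ltW.
rewrite quadD //.
have h4 : ga * quad (wgtP S) z <= ga * ((1 - ga) * M) by rewrite ler_wpM2l // ltW.
have h5 : ga^-1 * quad (wgtP S) g <= ga^-1 * cG by rewrite ler_wpM2l.
by move: hM; rewrite mulrDl mul1r; lra.
Qed.

End LyapunovBound.

Lemma admissible_smaller {R : realType} {q : nat} (W : set 'cV[R]_q) (eps : R) Sh :
  admissible W (eps, Sh) -> admissible W (0, Sh).
Proof.
move=> [/= e0 pS h]; split=> //= T [pT hT]; apply: h; split=> //=.
by apply: (le_trans hT); rewrite expr0n /= sqr_ge0.
Qed.

(** The ball of radius zero around zero contains zero only, which is the second moment of
   the point mass at the origin. *)
Lemma admissible0 {R : realType} {q : nat} (W : set 'cV[R]_q) :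
  W 0 -> admissible W (0, 0).
Proof.
move=> W0; split=> //=; first exact: psd0.
pose o : vecB R q := (0 : 'cV[R]_q).
move=> T /gelbrich_ball0 ->; exists (\d_o).
have E (f : vecB R q -> R) : measurable_fun setT f ->
    ('E_(\d_o)[f] = (f o)%:E)%E.
  move=> mf; rewrite unlock integral_dirac //; last exact/measurable_EFinP.
  by rewrite diracE mem_set // mul1e.
split; first split.
- by move=> i; rewrite E ?mxE //; exact: measurable_coord.
- have h : (dirac o (W : set (vecB R q)) = 1 :> \bar R)%E by rewrite diracE mem_set.
  exact: h.
- move=> i j; rewrite E ?mxE ?mulr0 //.
  by apply: measurable_funM; exact: measurable_coord.
Qed.

(** The limit is the cost of the noise per step under the gain, whatever [d]: a terminal
   set that is the whole space is the case of waiting time [0]. *)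
Lemma avg_perf_limit (R : realType) (n m q : nat) (S : mpc R n m q)
    (N_ge1 : (1 <= horizon S)%N)
    (Z_sub : conZ S `<=` [set z | inU S z.2])
    (cW : closed (disW S)) (cZ : closed (conZ S)) (cX : closed (terX S))
    (W0 : disW S 0)
    (bU : bounded_set (inU S)) (bW : bounded_set (disW S))
    (W_int : (disW S)° 0)
    (Q_pd : pd (wgtQ S)) (pR : pd (wgtR S)) (P_pd : pd (wgtP S))
    (X_bounded : bounded_set (feasible_set S) \/ terX S = setT)
    (ric : riccati S)
    (Xf_inv : forall x w, terX S x -> disW S w ->
       conZ S (x, gainK S *m x) /\
       terX S ((sysA S + sysB S *m gainK S) *m x + sysG S *m w))
    (Xf_int : (terX S)° 0)
    (d : R * 'M[R]_q) (kappa : 'cV[R]_n -> 'cV[R]_m)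
    (ad : admissible (disW S) d) (lawk : control_law S d kappa)
    (x : 'cV[R]_n) (P : probability (famB nat R q) R) (P0 : probability (vecB R q) R) :
  feasible_set S x -> noise (disW S) P -> (forall k, has_marginal P k P0) ->
  (forall eps : R, 0 < eps ->
    (0 < P0 [set w : vecB R q | (enorm (w : 'cV[R]_q) <= eps)%R])%E) ->
  avg_perf S kappa k x P @[k --> \oo] --> (step_noise_cost S P0)%:E.
Proof.
move=> Xx nP mP small; have pP := pd_psd P_pd; have pQ := pd_psd Q_pd.
have mX : measurable (feasible_set S : set (vecB R n)).
  exact: (closed_measurable_vecB (feasible_set_closed Z_sub cZ cX bU W0 W_int)).
have [mk kU _] := lawk.
have Xinv := control_invariant N_ge1 W0 Xf_inv lawk.
have XfK := terminal_control N_ge1 Z_sub cW bW bU W0 pR pP ric Xf_inv ad lawk.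
have Xf_step := terminal_step N_ge1 Z_sub cW bW bU W0 pR pP ric Xf_inv ad lawk.
have loop_bounded : exists b : R, forall w k, (forall i, disW S (w i)) ->
    ebound b (closed_loop S kappa x w k).
  case: X_bounded => [/bounded_ebound[b _ hb]|XfT].
    exists b => w k Ww; apply: hb.
    exact: (loop_feasible N_ge1 W0 Xf_inv lawk).
  by apply: gain_loop_bounded => // y; apply: XfK; rewrite XfT.
have [eps [T [eps0 hit]]] : exists (eps : R) (T : nat), 0 < eps /\
    forall y w, feasible_set S y -> (forall i, (i < T)%N -> enorm (w i) <= eps) ->
      terX S (closed_loop S kappa y w T).
  case: X_bounded => [/bounded_ebound[b _ hb]|XfT].
    exact: (hitting N_ge1 Z_sub cW bW bU W0 W_int Q_pd pR pP ric Xf_inv Xf_int ad lawk hb).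
  by exists 1, 0%N; split=> // y w _ _; rewrite XfT.
apply: avg_perf_cvg => //.
exact: (cexcess_sum cW bU W0 Xx mX mk kU Xinv loop_bounded nP mP cX XfK Xf_step
  eps0 hit (small _ eps0)).
Qed.

Theorem corollary3p6 (R : realType) (n m q : nat) (S : mpc R n m q)
    (kappa : R * 'M[R]_q -> 'cV[R]_n -> 'cV[R]_m)
    (N_ge1 : (1 <= horizon S)%N)
    (Z_sub : conZ S `<=` [set z | inU S z.2])
    (kappaP : forall d, admissible (disW S) d -> control_law S d (kappa d))
    (closedS : [/\ closed (inU S), closed (disW S), closed (conZ S)
                 & closed (terX S)])
    (convexS : [/\ convex_set (inU S), convex_set (disW S),
                   convex_set (conZ S) & convex_set (terX S)])
    (zeroS : [/\ inU S 0, disW S 0, conZ S (0, 0) & terX S 0])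
    (boundedS : bounded_set (inU S) /\ bounded_set (disW S))
    (W_int : (disW S)° 0)
    (psdS : [/\ psd (wgtQ S), psd (wgtR S) & psd (wgtP S)])
    (Q_pd : pd (wgtQ S))
    (X_bounded : bounded_set (feasible_set S) \/ terX S = setT)
    (RP_pd : pd (wgtR S) /\ pd (wgtP S))
    (P_riccati : riccati S)
    (Xf_inv : forall x w, terX S x -> disW S w ->
       conZ S (x, gainK S *m x) /\
       terX S ((sysA S + sysB S *m gainK S) *m x + sysG S *m w))
    (Xf_int : (terX S)° 0) :
  forall (x : 'cV[R]_n) (eps : R) (Sh : 'M[R]_q)
         (P : probability (famB nat R q) R),
    feasible_set S x -> admissible (disW S) (eps, Sh) ->
    iid_class (disW S) P ->
    exists l : R,
      [/\ avg_perf S (kappa (eps, Sh)) k x P @[k --> \oo] --> l%:E,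
          avg_perf S (kappa (0, Sh)) k x P @[k --> \oo] --> l%:E
        & avg_perf S (kappa (0, 0)) k x P @[k --> \oo] --> l%:E].
Proof.
move=> x eps Sh P Xx ad [iP [P0 [cP0 small mP]]].
have nP : noise (disW S) P by apply: iid_noise; split=> //; exists P0.
have [_ cW cZ cX] := closedS; have [_ W0 _ _] := zeroS; have [bU bW] := boundedS.
have lim d (ad' : admissible (disW S) d) := avg_perf_limit N_ge1 Z_sub cW cZ cX W0 bU bW
  W_int Q_pd RP_pd.1 RP_pd.2 X_bounded P_riccati Xf_inv Xf_int ad' (kappaP d ad') Xx nP mP small.
exists (step_noise_cost S P0); split; apply: lim => //.
- exact: admissible_smaller ad.
- exact: admissible0.
Qed.
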